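(* Let $P$ be a homologically admissible poset with cellular chain complex $(\mathcal{C}_*,d)$ and let $M'$ be a Morse matching on $P$ such that the family $\mathcal{R}_{M'}(P)$ of equivalence classes of rays in $\mathcal{H}_{M'}(P)$ is finite. Then there exists a chain complex $(\mathcal{M}_*,\overline{d})$, where for each $n$ the group $\mathcal{M}_n$ is a free abelian group with basis $\mathcal{C}_{M'}^n(P)\cup\mathcal{R}_{M'}^n(P)$, such that the homology groups of $(\mathcal{M}_*,\overline{d})$ and $(\mathcal{C}_*,d)$ are isomorphic.
   Context: Here $\mathbb{N}=\{0,1,2,\dots\}$. For a poset $P$ and $x\in P$ write $x\!\downarrow=\{y\in P: y\le x\}$ and $\hat{x}\!\downarrow=x\!\downarrow\smallsetminus\{x\}$. The length of a finite chain with $n+1$ elements is $n$. $P$ is graded if for every $x\in P$ all maximal chains in $x\!\downarrow$ are finite and have the same length, called $\deg(x)$. $P$ has finite principal ideals if $x\!\downarrow$ is finite for every $x$. The order complex $\mathcal{K}(P)$ is the (geometric realization of the) simplicial complex of finite nonempty chains of $P$. $P$ is homologically admissible if it is graded, has finite principal ideals, and for all $x\in P$ and every maximal element $y$ of $\hat{x}\!\downarrow$ the complex $\mathcal{K}(\hat{x}\!\downarrow\smallsetminus\{y\})$ is (nonempty and) connected with $H_n(\mathcal{K}(\hat{x}\!\downarrow\smallsetminus\{y\}))=0$ for all $n\ge 1$. For such $P$, each $\mathcal{K}(\hat{x}\!\downarrow)$ has the integral homology of a sphere of dimension $\deg(x)-1$. The cellular chain complex $(\mathcal{C}_*,d)$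 of $P$: let $P^{(n)}=\{x\in P:\deg(x)\le n\}$; $\mathcal{C}_n=H_n(\mathcal{K}(P^{(n)}),\mathcal{K}(P^{(n-1)});\mathbb{Z})$, which is free abelian with basis the elements of $P$ of degree $n$ ($x$ corresponding to a chosen generator of $H_n(\mathcal{K}(x\!\downarrow),\mathcal{K}(\hat{x}\!\downarrow))\cong\mathbb{Z}$), and $d$ is the connecting homomorphism of the triple $(\mathcal{K}(P^{(n)}),\mathcal{K}(P^{(n-1)}),\mathcal{K}(P^{(n-2)}))$. Its homology is the integral homology of $\mathcal{K}(P)$. The Hasse diagram $\mathcal{H}(P)$ is the digraph with vertex set $P$ and an arrow from $x$ to $y$ whenever $x$ covers $y$. A matching $M$ on $\mathcal{H}(P)$ is a set of arrows no two of which share a vertex; $\mathcal{H}_M(P)$ is obtained from $\mathcal{H}(P)$ by reversing the arrows in $M$. $M$ is a Morse matching if $\mathcal{H}_M(P)$ has no directed cycles. An element is critical if it belongs to no arrow of $M$; $\mathcal{C}_M^n(P)$ is the set of critical elements of degree $n$. A ray in a digraph is an infinite sequence $x_0,x_1,\dots$ of pairwise distinct vertices with an arrow from $x_i$ to $x_{i+1}$ for all $i$. Two rays $r,s$ are equivalent if there are $K,N\in\mathbb{N}$ with $r_{K+i}=s_{N+i}$ for all $i\in\mathbb{N}$. $\mathcal{R}_M(P)$ is the set of equivalence classes of rays in $\mathcal{H}_M(P)$. The degree of a ray $r$ is $\min_j\deg(r_j)$ (equivalent rays have the same degree); $\mathcal{R}_M^n(P)$ is the set of classes of rays of degree $n$.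 *)

(* Defs.v *)
From HB Require Import structures.
From mathcomp Require Import all_boot all_order all_algebra.
From mathcomp Require Import boolp classical_sets functions cardinality.
From mathcomp Require Import freeg zify.

Set Implicit Arguments.
Unset Strict Implicit.
Unset Printing Implicit Defensive.

Import Order.TTheory GRing.Theory.

Local Open Scope classical_set_scope.
Local Open Scope ring_scope.

(** * Subquotients and homology of chain complexes *)

Record subgroup (V : zmodType) (Z : zmodClosed V) :=
  Subgroup { subgroup_val : V; subgroup_valP : subgroup_val \in Z }.

HB.instance Definition _ (V : zmodType) (Z : zmodClosed V) :=
  [isSub for @subgroup_val V Z].
HB.instance Definition _ (V : zmodType) (Z : zmodClosed V) :=
  [Choice of subgroup Z by <:].
HB.instance Definition _ (V : zmodType) (Z : zmodClosed V) :=
  [SubChoice_isSubZmodule of subgroup Z by <:].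

Definition inner (V : zmodType) (Z B : zmodClosed V) : {pred subgroup Z} :=
  [pred z | val z \in B].
Arguments inner {V} Z B _ /.

Lemma inner_zmod_closed (V : zmodType) (Z B : zmodClosed V) :
  zmod_closed (inner Z B).
Proof.
split=> [|u v]; rewrite /inner !inE ?raddf0 ?rpred0 //.
by rewrite raddfB; exact: rpredB.
Qed.

HB.instance Definition _ (V : zmodType) (Z B : zmodClosed V) :=
  GRing.isZmodClosed.Build (subgroup Z) (inner Z B) (inner_zmod_closed Z B).

(* Z / (Z :&: B); for all homology groups below B is contained in Z. *)
Definition subquot (V : zmodType) (Z B : zmodClosed V) : Type :=
  Quotient.quot (inner Z B : zmodClosed (subgroup Z)).

HB.instance Definition _ (V : zmodType) (Z B : zmodClosed V) :=
  ZmodQuotient.on (subquot Z B).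

Definition subquot_class (V : zmodType) (Z B : zmodClosed V) :
  subgroup Z -> subquot Z B := \pi_(subquot Z B)%qT.

Lemma subquot_classK (V : zmodType) (Z B : zmodClosed V) (q : subquot Z B) :
  subquot_class B (repr q) = q.
Proof. exact: reprK. Qed.

Lemma subquot_class_is_additive (V : zmodType) (Z B : zmodClosed V) :
  zmod_morphism (@subquot_class V Z B).
Proof. by move=> x y; rewrite /subquot_class raddfB. Qed.

HB.instance Definition _ (V : zmodType) (Z B : zmodClosed V) :=
  GRing.isZmodMorphism.Build (subgroup Z) (subquot Z B) (@subquot_class V Z B)
    (@subquot_class_is_additive V Z B).

Lemma subquot_classP (V : zmodType) (Z B : zmodClosed V) (x y : subgroup Z) :
  (subquot_class B x = subquot_class B y) <-> (val x - val y \in B).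
Proof.
rewrite -raddfB; have -> : (val (x - y) \in B) = (x - y \in inner Z B) by [].
by rewrite Quotient.idealrBE; split=> /eqP.
Qed.

Section SubquotMap.
Context (V W : zmodType) (Z B : zmodClosed V) (Z' B' : zmodClosed W).
Context (f : {additive V -> W}).
Context (fZ : forall z, z \in Z -> f z \in Z').
Context (fB : forall z, z \in Z -> z \in B -> f z \in B').

Definition subgroup_map (z : subgroup Z) : subgroup Z' :=
  Subgroup (fZ (subgroup_valP z)).

Definition subquot_map_fun (q : subquot Z B) : subquot Z' B' :=
  subquot_class B' (subgroup_map (repr q)).

Lemma subquot_map_fun_class z :
  subquot_map_fun (subquot_class B z) = subquot_class B' (subgroup_map z).
Proof.
apply/subquot_classP; rewrite /= -raddfB; apply: fB.
  by rewrite rpredB ?subgroup_valP.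
by apply/subquot_classP; rewrite subquot_classK.
Qed.

Lemma subquot_map_fun_is_additive : zmod_morphism subquot_map_fun.
Proof.
move=> x y; rewrite -[x]subquot_classK -[y]subquot_classK -raddfB.
rewrite !subquot_map_fun_class -raddfB; congr (subquot_class _ _).
by apply: val_inj; rewrite /= !raddfB.
Qed.

#[local] HB.instance Definition _ :=
  GRing.isZmodMorphism.Build (subquot Z B) (subquot Z' B') subquot_map_fun
    subquot_map_fun_is_additive.
Definition subquot_map : {additive subquot Z B -> subquot Z' B'} :=
  subquot_map_fun.

Lemma subquot_map_class z :
  subquot_map (subquot_class B z) = subquot_class B' (subgroup_map z).
Proof. exact: subquot_map_fun_class. Qed.
End SubquotMap.
Arguments subquot_map {V W Z B Z' B' f} fZ fB.

Record chain_complex := ChainComplex {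
  chain_group :> nat -> zmodType;
  diff : forall n, {additive chain_group n.+1 -> chain_group n};
  diff_diff : forall n (c : chain_group n.+2), diff n (diff n.+1 c) = 0
}.

Definition cycles (K : chain_complex) (n : nat) : {pred K n} :=
  match n with
  | 0 => predT
  | m.+1 => [pred c | diff K m c == 0]
  end.
Arguments cycles K n _ : clear implicits.

Definition boundaries (K : chain_complex) (n : nat) : {pred K n} :=
  [pred c | `[< exists b : K n.+1, c = diff K n b >] ].
Arguments boundaries K n _ : clear implicits.

Lemma cycles_zmod_closed (K : chain_complex) n : zmod_closed (cycles K n).
Proof.
case: n => [//|n]; split=> [|u v]; rewrite !inE; first by rewrite raddf0.
by move=> /eqP u0 /eqP v0; rewrite raddfB u0 v0 subrr.
Qed.

HB.instance Definition _ (K : chain_complex) (n : nat) :=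
  GRing.isZmodClosed.Build (K n) (cycles K n) (cycles_zmod_closed K n).

Lemma boundariesP (K : chain_complex) n (c : K n) :
  reflect (exists b : K n.+1, c = diff K n b) (c \in boundaries K n).
Proof. exact: asboolP. Qed.

Lemma boundaries_zmod_closed (K : chain_complex) n :
  zmod_closed (boundaries K n).
Proof.
split=> [|u v]; first by apply/boundariesP; exists 0; rewrite raddf0.
move=> /boundariesP[b ->] /boundariesP[b' ->].
by apply/boundariesP; exists (b - b'); rewrite raddfB.
Qed.

HB.instance Definition _ (K : chain_complex) (n : nat) :=
  GRing.isZmodClosed.Build (K n) (boundaries K n) (boundaries_zmod_closed K n).

Definition homology (K : chain_complex) (n : nat) : zmodType :=
  subquot (cycles K n) (boundaries K n).

Definition group_isomorphic (V W : zmodType) : Prop :=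
  exists f : {additive V -> W}, bijective f.

(* V is free abelian with basis the family b. *)
Definition is_basis (T : choiceType) (V : zmodType) (b : T -> V) : Prop :=
  forall v : V, exists! c : {freeg T / int},
    v = \sum_(t <- dom c) b t *~ coeff t c.

(** * Posets *)

Section Posets.
Context (disp : Order.disp_t) (P : porderType disp).
Implicit Types (x y : P) (A C D : set P) (n : nat).

Definition down x : set P := [set y | y <= x]%O.

Definition strict_down x : set P := down x `\ x.

Definition covers x y : Prop := (y < x)%O /\ ~ exists z, (y < z < x)%O.

Definition is_chain C : Prop := forall x y, C x -> C y -> (x >=< y)%O.

Definition is_maximal_chain D C : Prop :=
  [/\ C `<=` D, is_chain C &
      forall C', C' `<=` D -> is_chain C' -> C `<=` C' -> C' = C].

Definition is_maximal_element D y : Prop :=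
  D y /\ forall z, D z -> ~ (y < z)%O.

(* A chain with n+1 elements has length n. *)
Definition is_degree x n : Prop :=
  forall C, is_maximal_chain (down x) C -> (C #= `I_n.+1)%card.

Definition graded : Prop := forall x, exists n, is_degree x n.

(* Only meaningful when P is graded. The degree is then uniquely determined,
   as down x contains a maximal chain. *)
Definition degree x : nat := xget 0%N [set n | is_degree x n].

Definition finite_principal_ideals : Prop := forall x, finite_set (down x).
End Posets.

(** * Simplicial homology of order complexes *)

Section OrderComplex.
Context (disp : Order.disp_t) (P : porderType disp).
Implicit Types (A B C : set P) (n : nat).

(* The n-simplices of K(A) are the tuples x_0 < ... < x_n in A; the chains of
   K(A) form a subgroup of the free abelian group on all (n+1)-tuples. *)
Definition simplicial_chains A n : {pred {freeg (n.+1.-tuple P) / int}} :=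
  [pred c | `[< forall s : n.+1.-tuple P, s \in dom c ->
                  sorted <%O s /\ forall x, x \in s -> A x >] ].
Arguments simplicial_chains A n _ : clear implicits.

Lemma simplicial_chainsP A n (c : {freeg (n.+1.-tuple P) / int}) :
  reflect (forall s : n.+1.-tuple P, s \in dom c ->
             sorted <%O s /\ forall x, x \in s -> A x)
          (c \in simplicial_chains A n).
Proof. exact: asboolP. Qed.

Lemma simplicial_chains_zmod_closed A n :
  zmod_closed (simplicial_chains A n).
Proof.
split=> [|u v /simplicial_chainsP hu /simplicial_chainsP hv].
  by apply/simplicial_chainsP => s; rewrite dom0.
apply/simplicial_chainsP => s /domB; rewrite mem_cat => /orP[/hu|/hv] //.
Qed.

HB.instance Definition _ A n :=
  GRing.isZmodClosed.Build {freeg (n.+1.-tuple P) / int}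
    (simplicial_chains A n) (simplicial_chains_zmod_closed A n).

Definition face n (i : 'I_n.+2) (s : n.+2.-tuple P) : n.+1.-tuple P :=
  [tuple tnth s (fintype.lift i j) | j < n.+1].

Definition boundary n (c : {freeg (n.+2.-tuple P) / int}) :
    {freeg (n.+1.-tuple P) / int} :=
  fglift (fun s => \sum_(i < n.+2) << (-1) ^+ i *g face i s >>) c.

Lemma boundary_is_additive n : zmod_morphism (@boundary n).
Proof. exact: lift_is_additive. Qed.

HB.instance Definition _ n :=
  GRing.isZmodMorphism.Build {freeg (n.+2.-tuple P) / int}
    {freeg (n.+1.-tuple P) / int} (@boundary n) (@boundary_is_additive n).

Lemma boundaryU n (s : n.+2.-tuple P) :
  boundary << s >> = \sum_(i < n.+2) << (-1) ^+ i *g face i s >>.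
Proof. by rewrite /boundary liftU scale1r. Qed.

Lemma freeg_sumMz (T : choiceType) (c : {freeg T / int}) :
  c = \sum_(s <- dom c) << s >> *~ coeff s c.
Proof.
rewrite -{1}[c]freeg_sumE; apply: eq_bigr => s _.
by rewrite freegU_mulz intz.
Qed.

Lemma sorted_face n (i : 'I_n.+2) (s : n.+2.-tuple P) :
  sorted <%O s -> sorted <%O (face i s).
Proof.
move=> s_lt; pose x0 := tnth s ord0.
have h (j k : 'I_n.+2) : (j < k)%N -> (tnth s j < tnth s k)%O.
  move=> jk; rewrite (tnth_nth x0 s j) (tnth_nth x0 s k).
  by apply: (sorted_ltn_nth lt_trans) => //; rewrite inE size_tuple.
apply/(sortedP x0) => k; rewrite size_tuple => kn.
rewrite -(tnth_nth x0 (face i s) (Ordinal kn)).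
rewrite -(tnth_nth x0 (face i s) (Ordinal (ltnW kn))) !tnth_mktuple.
by apply: h => /=; rewrite /bump; lia.
Qed.

Lemma boundary_chains A n c :
  c \in simplicial_chains A n.+1 -> boundary c \in simplicial_chains A n.
Proof.
move=> /simplicial_chainsP hc; rewrite [c]freeg_sumMz raddf_sum big_seq.
apply: rpred_sum => s /hc[s_lt sA]; rewrite raddfMz; apply: rpredMz.
rewrite /= boundaryU; apply: rpred_sum => i _.
apply/simplicial_chainsP => t.
rewrite domU ?signr_eq0 // inE => /eqP ->; split; first exact: sorted_face.
by move=> x /tnthP[j ->]; rewrite tnth_mktuple; apply: sA; exact: mem_tnth.
Qed.

Lemma boundary_boundary n (c : {freeg (n.+3.-tuple P) / int}) :
  boundary (boundary c) = 0.
Proof.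
rewrite [c]freeg_sumMz !raddf_sum big1 // => s _.
rewrite !raddfMz /= boundaryU raddf_sum /=.
suff -> : \sum_(i < n.+3) boundary << (-1) ^+ i *g face i s >> = 0.
  by rewrite mul0rz.
under eq_bigr => i _.
  rewrite -[X in << X *g _ >>]intz -freegU_mulz raddfMz /= boundaryU mulrz_suml.
  over.
rewrite (pair_bigA _ (fun (i : 'I_n.+3) (j : 'I_n.+2) =>
  << (-1) ^+ j *g face j (face i s) >> *~ (-1) ^+ i)) /=.
rewrite (bigID (fun p : 'I_n.+3 * 'I_n.+2 => (p.2 < p.1)%N)) /=.
pose h (p : 'I_n.+3 * 'I_n.+2) : 'I_n.+3 * 'I_n.+2 :=
  (inord p.2.+1, inord p.1).
pose h' (p : 'I_n.+3 * 'I_n.+2) : 'I_n.+3 * 'I_n.+2 :=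
  (inord p.2, inord p.1.-1).
rewrite (reindex_onto h h') /=; last first.
  move=> [[i i_lt] [j j_lt]] /= ji; rewrite /h /h' /=.
  by congr pair; apply: val_inj; rewrite /= !inordK //=; lia.
rewrite (eq_bigl (fun p : 'I_n.+3 * 'I_n.+2 => ~~ (p.2 < p.1)%N)); last first.
  move=> [[i i_lt] [j j_lt]]; rewrite /h /h' /=.
  rewrite (@inordK n.+2 j.+1) ?ltnS //.
  have [ji|ij] := ltnP j i.
    apply/negbTE/negP => /andP[lt_ij /eqP[/(congr1 val) /= eq_i _]].
    have i_le : ((inord i : 'I_n.+2) < n.+2)%N by exact: ltn_ord.
    rewrite inordK in eq_i; last exact: ltnW.
    by rewrite eq_i in lt_ij; lia.
  rewrite inordK ?ltnS //=; last by lia.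
  rewrite ij /=; apply/eqP; congr pair; apply: val_inj; rewrite /= !inordK //=.
rewrite -big_split big1 // => -[[i i_lt] [j j_lt]] /=; rewrite -leqNgt => ij.
rewrite /h /= (@inordK n.+2 j.+1) ?ltnS // (@inordK n.+1 i); last by lia.
set t := face _ _; set t' := face _ _.
have -> : t = t'.
  apply: eq_from_tnth => k; rewrite /t /t' !tnth_mktuple; congr tnth.
  apply: val_inj; rewrite /= !inordK //=; last by lia.
  by rewrite /bump; lia.
rewrite !freeg_mulz freegUD; apply/eqP; rewrite freegU_eq0 !mulrzz.
by rewrite exprS mulN1r mulrN mulrC addNr.
Qed.

(* Homology of the pair (K(A), K(B)), B contained in A: relative cycles (chains
   of K(A) with boundary in K(B)) modulo relative boundaries. *)
Definition rel_cycles A B n : {pred {freeg (n.+1.-tuple P) / int}} :=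
  match n with
  | 0 => simplicial_chains A 0
  | m.+1 => [pred c | (c \in simplicial_chains A m.+1) &&
                      (boundary c \in simplicial_chains B m)]
  end.
Arguments rel_cycles A B n _ : clear implicits.

Definition rel_boundaries A B n : {pred {freeg (n.+1.-tuple P) / int}} :=
  [pred c | `[< exists b a, [/\ b \in simplicial_chains A n.+1,
                  a \in simplicial_chains B n & c = boundary b + a] >] ].
Arguments rel_boundaries A B n _ : clear implicits.

Lemma rel_boundariesP A B n c :
  reflect (exists b a, [/\ b \in simplicial_chains A n.+1,
             a \in simplicial_chains B n & c = boundary b + a])
          (c \in rel_boundaries A B n).
Proof. exact: asboolP. Qed.

Lemma rel_cycles_zmod_closed A B n : zmod_closed (rel_cycles A B n).
Proof.
case: n => [|n]; first exact: simplicial_chains_zmod_closed.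
split=> [|u v /andP[uA uB] /andP[vA vB]]; apply/andP.
  by rewrite raddf0 !rpred0.
by rewrite raddfB !rpredB.
Qed.

HB.instance Definition _ A B n :=
  GRing.isZmodClosed.Build {freeg (n.+1.-tuple P) / int}
    (rel_cycles A B n) (rel_cycles_zmod_closed A B n).

Lemma rel_boundaries_zmod_closed A B n : zmod_closed (rel_boundaries A B n).
Proof.
split=> [|u v].
  by apply/rel_boundariesP; exists 0, 0; rewrite !rpred0 raddf0 addr0.
move=> /rel_boundariesP[b [a [bA aB ->]]] /rel_boundariesP[b' [a' [bA' aB' ->]]].
apply/rel_boundariesP; exists (b - b'), (a - a'); rewrite !rpredB //; split=> //.
by rewrite raddfB addrACA -opprD.
Qed.

HB.instance Definition _ A B n :=
  GRing.isZmodClosed.Build {freeg (n.+1.-tuple P) / int}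
    (rel_boundaries A B n) (rel_boundaries_zmod_closed A B n).

Definition rel_homology A B n : zmodType :=
  subquot (rel_cycles A B n) (rel_boundaries A B n).

Definition simplicial_homology A n : zmodType := rel_homology A set0 n.

(* Vertices x, y of K(A) span a simplex iff x and y are comparable. *)
Definition complex_connected A : Prop :=
  forall x y, A x -> A y -> exists p : seq P,
    [/\ path >=<%O x p, last x p = y & forall z, z \in p -> A z].

Lemma boundary_rel_cycles A B C n c :
  c \in rel_cycles A B n.+1 -> boundary c \in rel_cycles B C n.
Proof.
move=> /andP[cA cB]; case: n => [//|n] in c cA cB *.
by apply/andP; rewrite cB boundary_boundary rpred0.
Qed.

Lemma boundary_rel_boundaries A B C n c : c \in rel_cycles A B n.+1 ->
  c \in rel_boundaries A B n.+1 -> boundary c \in rel_boundaries B C n.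
Proof.
move=> _ /rel_boundariesP[b [a [bA aB ->]]]; apply/rel_boundariesP; exists a, 0.
by rewrite aB rpred0 raddfD /= boundary_boundary add0r addr0.
Qed.

(* The connecting homomorphism H_(n+1)(K(A), K(B)) -> H_n(K(B), K(C)). *)
Definition connecting A B C n :
    {additive rel_homology A B n.+1 -> rel_homology B C n} :=
  subquot_map (f := @boundary n) (@boundary_rel_cycles A B C n)
    (@boundary_rel_boundaries A B C n).

Lemma connecting_class A B C n (z : subgroup (rel_cycles A B n.+1)) :
  connecting A B C n (subquot_class _ z) =
  subquot_class _ (subgroup_map (f := @boundary n)
                     (@boundary_rel_cycles A B C n) z).
Proof. exact: subquot_map_class. Qed.

(* P^(n-1), in particular the empty set for n = 0. *)
Definition skeleton n : set P := [set x | (degree x < n)%N].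

Definition cellular_group n : zmodType :=
  rel_homology (skeleton n.+1) (skeleton n) n.

Definition cellular_diff n :
    {additive cellular_group n.+1 -> cellular_group n} :=
  connecting (skeleton n.+2) (skeleton n.+1) (skeleton n) n.

Lemma cellular_diff_diff n (c : cellular_group n.+2) :
  cellular_diff n (cellular_diff n.+1 c) = 0.
Proof.
rewrite -[c]subquot_classK /cellular_diff !connecting_class.
rewrite -(raddf0 (subquot_class _)); apply/subquot_classP.
by rewrite /= boundary_boundary subrr rpred0.
Qed.

Definition cellular_complex : chain_complex := ChainComplex cellular_diff_diff.

Definition homologically_admissible : Prop :=
  [/\ graded P, finite_principal_ideals P &
      forall x y, is_maximal_element (strict_down x) y ->
        let A := strict_down x `\ y in
        [/\ A !=set0, complex_connected A &
            forall n, (0 < n)%N ->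
              forall h : simplicial_homology A n, h = 0] ].
End OrderComplex.

Arguments homologically_admissible {disp} P.
Arguments cellular_complex {disp} P.

(** * Morse matchings and rays *)

Section Matchings.
Context (disp : Order.disp_t) (P : porderType disp).
(* (x, y) \in M stands for the arrow from x to y of the Hasse diagram. *)
Implicit Types (M : set (P * P)) (r s : nat -> P) (n : nat).

Definition matching M : Prop :=
  (forall x y, M (x, y) -> covers x y) /\
  (forall x y x' y', M (x, y) -> M (x', y') ->
     [\/ x = x', x = y', y = x' | y = y'] -> (x, y) = (x', y')).

Definition hasse_arrow M : rel P :=
  fun x y => `[< (covers x y /\ ~ M (x, y)) \/ M (y, x) >].

Definition morse_matching M : Prop :=
  matching M /\ forall c : seq P, c != [::] -> ~~ cycle (hasse_arrow M) c.

Definition critical M : set P :=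
  [set x | forall y, ~ M (x, y) /\ ~ M (y, x)].

Definition critical_degree M n : set P :=
  critical M `&` [set x | degree x = n].

Definition is_ray M r : Prop :=
  injective r /\ forall i, hasse_arrow M (r i) (r i.+1).

Definition ray_equiv r s : Prop :=
  exists K N : nat, forall i, r (K + i)%N = s (N + i)%N.

Definition ray_class M r : set (nat -> P) :=
  [set s | is_ray M s /\ ray_equiv r s].

Definition ray_classes M : set (set (nat -> P)) :=
  [set ray_class M r | r in is_ray M].

Definition ray_degree r n : Prop :=
  (exists j, degree (r j) = n) /\ forall j, (n <= degree (r j))%N.

(* Equivalent rays have the same degree: in hasse_arrow M two upward steps are
   never consecutive, so discarding an initial segment of a ray does not change
   its minimal degree. *)
Definition ray_classes_degree M n : set (set (nat -> P)) :=
  [set ray_class M r | r in [set r | is_ray M r /\ ray_degree r n] ].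
End Matchings.

(* Main.v *)
From HB Require Import structures.
Require Import Defs.
From mathcomp Require Import all_boot all_order all_algebra.
From mathcomp Require Import finmap boolp classical_sets functions cardinality.
From mathcomp Require Import freeg zify.

(** The argument has three parts.

    The cellular complex. Degrees increase strictly along chains, so a chain
    with n + 1 elements of degree at most n ends in degree n, and the n-th
    cellular group consists of the n-chains on the elements of degree at most n
    whose boundary involves only smaller degrees. Sorting such a chain by the
    last elements x of its simplices yields one reduced cycle of dimension
    n - 1 on the elements below x for each x of degree n. The main point,
    sphere_cycle_coeff, is that the coefficient of any given maximal chain
    determines such a cycle and may be any integer; admissibility enters here,
    in an induction that deletes the last element y of the chain and uses that
    the elements below x other than y form an acyclic complex. It follows in
    cellular_cell_basis that the elements of degree n index a basis, and that
    the differential has coefficient 1 or -1 at covering pairs and 0 elsewhere.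

    Matchings without rays. A Morse matching M is rayless precisely when the
    digraph of M has no infinite walk, and then induction along its arrows is
    available. Let D be the span of the upper elements of M in the complex.
    Since M is acyclic, d is injective on D, even after projection to the lower
    elements (diff_upper_inj), so the subcomplex D + dD is acyclic. Induction
    along the arrows shows that D + dD and the critical elements span the
    complex (elt_decomposable), and the sum is direct. The quotient by D + dD is
    therefore free on the critical elements and has the same homology
    (rayless_morse_complex).

    Getting rid of the rays. If there are rays, but only finitely many classes,
    then some vertex x starts exactly one infinite walk (pure_exists): otherwise
    branches would occur again and again, and one could choose a ray that leaves
    each representative infinitely often. A tail r of that walk alternates
    between matched steps up and unmatched steps down. Exchanging its matched
    and unmatched arrows reverses r in the digraph. From the reversed r one can
    only descend along r or escape to vertices without infinite walks. So no
    cycle arises, the ray class of r disappears, all other classes survive, and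
    the single element r 0, whose degree is that of r, becomes critical. Repeating
    this turns M' into a rayless Morse matching whose critical elements are those
    of M' and one for each ray class (reverse_all_rays), in matching degrees. *)

Set Implicit Arguments.
Unset Strict Implicit.
Unset Printing Implicit Defensive.

Import Defs Order.TTheory GRing.Theory.

Local Open Scope classical_set_scope.
Local Open Scope ring_scope.

(** * Degrees in a graded poset *)

Section Degree.
Context (disp : Order.disp_t) (P : porderType disp).
Implicit Types (x y z : P) (C D : set P).

Lemma is_chain_sub C D : C `<=` D -> is_chain D -> is_chain C.
Proof. by move=> CD hD x y /CD Dx /CD; apply: hD. Qed.

(** Zorn's lemma. The subsets X range over those for which X together with C is
    still a chain, so that the empty family needs no separate treatment. *)
Lemma maximal_chain_extending D C : C `<=` D -> is_chain C ->
  exists C', is_maximal_chain D C' /\ C `<=` C'.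
Proof.
move=> CD hC.
pose ok := [set X : set P | X `|` C `<=` D /\ is_chain (X `|` C)].
have [F okF totF|X [[XD hX] Xmax]] := @Zorn_bigcup P ok.
  split.
    by move=> x [[X FX Xx]|/CD//]; apply: (okF _ FX).1; left.
  have key X x y : F X -> (X `|` C) x -> (X `|` C) y -> (x >=< y)%O.
    by move=> FX; apply: (okF _ FX).2.
  move=> x y [[X FX Xx]|Cx] [[Y FY Yy]|Cy].
  - have [XY|YX] := totF _ _ FX FY.
      by apply: (key Y) => //; left=> //; apply: XY.
    by apply: (key X) => //; left=> //; apply: YX.
  - by apply: (key X) => //; [left|right].
  - by apply: (key Y) => //; [right|left].
  - exact: hC.
exists (X `|` C); split; last by right.
split=> // C' C'D hC' sub; apply/seteqP; split=> // x C'x.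
have [//|nx] := pselect ((X `|` C) x).
have E : C' `|` C = C'.
  by apply/seteqP; split=> y; [case=> // Cy; apply: sub; right|left].
exfalso; apply: (Xmax C'); last by rewrite /ok /= E.
rewrite properEneq; split; last by move=> y Xy; apply: sub; left.
by apply/eqP => EX; apply: nx; left; rewrite EX.
Qed.

Hypothesis Pgr : graded P.

Lemma is_degree_degree x : is_degree x (degree x).
Proof.
by rewrite /degree; case: xgetP => [n -> //|h]; have [n hn] := Pgr x; case: (h n).
Qed.

Lemma down_refl x : down x x. Proof. exact: lexx. Qed.

Lemma is_chain1 x : is_chain [set x].
Proof. by move=> y z -> ->; rewrite comparablexx. Qed.

Lemma is_chainU1 C x : is_chain C -> C `<=` down x -> is_chain (x |` C).
Proof.
move=> hC Cx y z [->|Cy] [->|Cz]; rewrite ?comparablexx //.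
- by rewrite comparable_sym; apply: le_comparable; apply: Cx.
- by apply: le_comparable; apply: Cx.
- exact: hC.
Qed.

Lemma card_set_add1 C x n : (C #= `I_n)%card -> ~ C x ->
  ((x |` C) #= `I_n.+1)%card.
Proof.
move=> Cn nx; have Cfin : finite_set C by exists n.
have xCfin : finite_set (x |` C) by rewrite finite_setU.
rewrite -[x |` C]fset_setK //; apply/card_eq_fsetP.
rewrite fset_setU1 // cardfsU1 (card_fset_set Cn) in_fset_set //.
by rewrite memNset.
Qed.

Lemma maximal_chain_down y C : is_maximal_chain (down y) C -> C y.
Proof.
case=> Cy hC Cmax; have <- : y |` C = C; last by left.
apply: Cmax; last by right.
- by move=> z [->|/Cy//]; exact: down_refl.
- exact: is_chainU1.
Qed.

Lemma down_restriction x y C C' : (y <= x)%O -> is_maximal_chain (down y) C ->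
  is_maximal_chain (down x) C' -> C `<=` C' -> C' `&` down y = C.
Proof.
move=> yx [Cy hC Cmax] [_ hC' _] CC'; apply: Cmax.
- by move=> z [].
- by apply: is_chain_sub hC' => z [].
- by move=> z Cz; split; [exact: CC'|exact: Cy].
Qed.

Lemma card_maximal_chain x C : is_maximal_chain (down x) C ->
  (C #= `I_(degree x).+1)%card.
Proof. exact: is_degree_degree. Qed.

(** Degrees of y < x are compared through a maximal chain below y and one
    below x that prolongs it by at least x. *)
Lemma extend_maximal_chain x y : (y < x)%O -> exists C C',
  [/\ is_maximal_chain (down y) C, is_maximal_chain (down x) C',
      x |` C `<=` C' & ~ C x].
Proof.
move=> yx; have [C [Cmax _]] : exists C, is_maximal_chain (down y) C /\ set0 `<=` C.
  exact: maximal_chain_extending.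
have Cy : C `<=` down y by case: Cmax.
have Cx : C `<=` down x.
  by move=> z /Cy zy; apply: le_trans zy _; exact: ltW.
have xCx : x |` C `<=` down x by move=> z [->|/Cx//]; exact: down_refl.
have [C' [C'max CC']] : exists C', is_maximal_chain (down x) C' /\ x |` C `<=` C'.
  by apply: maximal_chain_extending => //; apply: is_chainU1 => //; case: Cmax.
exists C, C'; split=> //.
by move=> /Cy /(lt_le_trans yx); rewrite ltxx.
Qed.

Lemma degree_lt x y : (y < x)%O -> (degree y < degree x)%N.
Proof.
move=> /extend_maximal_chain[C [C' [Cmax C'max CC' nCx]]].
have h1 := card_set_add1 (card_maximal_chain Cmax) nCx.
have h2 := card_maximal_chain C'max.
have := subset_card_le CC'.
by rewrite (card_le_eql h1) (card_le_eqr h2) card_le_II ltnS.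
Qed.

Lemma degree_covers x y : covers x y -> degree x = (degree y).+1.
Proof.
case=> yx nz; have [C [C' [Cmax C'max CC' nCx]]] := extend_maximal_chain yx.
have h1 := card_set_add1 (card_maximal_chain Cmax) nCx.
have h2 := card_maximal_chain C'max.
have CC'2 : C `<=` C' by move=> z Cz; apply: CC'; right.
(* An element of C' outside x and C would lie strictly between y and x. *)
have E : C' = x |` C.
  apply/seteqP; split=> // z C'z.
  have [zy|nzy] := boolP (z <= y)%O.
    by right; rewrite -(down_restriction (ltW yx) Cmax C'max CC'2).
  left; case: C'max => C'x hC' _; apply/eqP; apply/negPn/negP => /= zx.
  apply: nz; exists z; rewrite [(z < x)%O]lt_neqAle zx [(z <= x)%O]C'x // andbT.
  have := hC' y z (CC'2 _ (maximal_chain_down Cmax)) C'z.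
  rewrite /Order.comparable (negbTE nzy) orbF lt_neqAle => ->.
  by rewrite !andbT; apply: contraNneq nzy => <-.
move: h2; rewrite E => h2.
have := card_eq_trans (card_esym h1) h2.
by move=> /card_eq_II [].
Qed.

(** An element of maximal degree below x is covered by x. *)
Lemma cover_below x n : degree x = n.+1 ->
  exists2 y, (y < x)%O & degree y = n.
Proof.
move=> dx.
have [[y0 y0x]|none] := pselect (exists y, (y < x)%O); last first.
  have xmax : is_maximal_chain (down x) [set x].
    split; first by move=> z ->; exact: down_refl.
      exact: is_chain1.
    move=> C' C'x _ xC'; apply/seteqP; split=> // z C'z; apply/eqP.
    by apply/negPn/negP => zx; apply: none; exists z; rewrite lt_neqAle zx C'x.
  have := card_maximal_chain xmax; rewrite dx => h.
  have h1 : ([set x] #= `I_1)%card by rewrite card_set1.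
  by have := card_eq_trans (card_esym h1) h => /card_eq_II.
have ex : exists m, `[< exists2 y, (y < x)%O & degree y = m >].
  by exists (degree y0); apply/asboolP; exists y0.
have ub m : `[< exists2 y, (y < x)%O & degree y = m >] -> (m <= n)%N.
  by move=> /asboolP[y yx <-]; rewrite -ltnS -dx; exact: degree_lt.
case: (ex_maxnP ex ub) => m /asboolP[y yx ym] mmax.
exists y => //; suff: covers x y by move=> /degree_covers; rewrite dx => -[].
split=> // -[z /andP[yz zx]]; have := degree_lt yz; rewrite ym ltnNge => /negP[].
by apply: mmax; apply/asboolP; exists z.
Qed.

Lemma lt_degree_covers x y : (y < x)%O -> degree x = (degree y).+1 ->
  covers x y.
Proof.
move=> yx dx; split=> // -[z /andP[yz zx]].
by have := degree_lt yz; have := degree_lt zx; lia.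
Qed.

End Degree.

(** * Free abelian groups: supports and induced maps *)

Lemma raddfZ_int (V W : lmodType int) (f : {additive V -> W}) k v :
  f (k *: v) = k *: f v.
Proof. by rewrite -[k]intz !scaler_int raddfMz. Qed.

Section FreegExtra.
Context (T U : choiceType).

HB.instance Definition _ (M : lmodType int) (f : T -> M) :=
  GRing.isZmodMorphism.Build {freeg T / int} M (fglift f)
    (@lift_is_additive _ _ M f).

Lemma freeg_ext (V : zmodType) (f g : {additive {freeg T / int} -> V})
    (c : {freeg T / int}) :
  (forall s, s \in dom c -> f << s >> = g << s >>) -> f c = g c.
Proof.
move=> fg; rewrite [c]freeg_sumMz !raddf_sum !big_seq.
by apply: eq_bigr => s /fg h; rewrite !raddfMz h.
Qed.

Lemma fgliftU (M : lmodType int) (f : T -> M) s : fglift f << s >> = f s.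
Proof. by rewrite liftU scale1r. Qed.

Lemma coeffU1 (s t : T) : coeff s (<< t >> : {freeg T / int}) = (t == s)%:R.
Proof. by rewrite coeffU mul1r. Qed.

Lemma freegP (c d : {freeg T / int}) :
  (forall s, coeff s c = coeff s d) -> c = d.
Proof. by move=> h; apply/eqP/freeg_eqP. Qed.

Definition supported (A : set T) : {pred {freeg T / int}} :=
  [pred c | `[< forall s, s \in dom c -> A s >] ].

Lemma supportedP A c :
  reflect (forall s, s \in dom c -> A s) (c \in supported A).
Proof. exact: asboolP. Qed.

Lemma supported_zmod_closed A : zmod_closed (supported A).
Proof.
split=> [|u v /supportedP hu /supportedP hv].
  by apply/supportedP => s; rewrite dom0.
by apply/supportedP => s /domB; rewrite mem_cat => /orP[/hu|/hv].
Qed.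

HB.instance Definition _ A :=
  GRing.isZmodClosed.Build {freeg T / int}
    (supported A) (supported_zmod_closed A).

Lemma supportedU (A : set T) s : A s -> << s >> \in supported A.
Proof. by move=> As; apply/supportedP => t; rewrite domU1 inE => /eqP ->. Qed.

Lemma supported_sub (A B : set T) c :
  A `<=` B -> c \in supported A -> c \in supported B.
Proof. by move=> AB /supportedP cA; apply/supportedP => s /cA /AB. Qed.

Lemma supported0 c : c \in supported set0 -> c = 0.
Proof.
move=> /supportedP h; apply/eqP; rewrite -dom_eq0.
by case: (dom c) h => // s l /(_ s (mem_head _ _)).
Qed.

End FreegExtra.

Lemma supported_lift (T U : choiceType) (A : set T) (B : set U)
    (f : T -> {freeg U / int}) c :
  (forall s, A s -> f s \in supported B) -> c \in supported A ->
  fglift f c \in supported B.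
Proof.
move=> AB /supportedP cA; rewrite [c]freeg_sumMz raddf_sum big_seq.
by apply: rpred_sum => s /cA /AB fs; rewrite raddfMz /= fgliftU rpredMz.
Qed.

Section Push.
Context (T U : choiceType) (f : T -> U).

Definition push : {freeg T / int} -> {freeg U / int} :=
  fglift (fun s => << f s >>).

HB.instance Definition _ := GRing.Additive.on push.

Lemma pushU s : push << s >> = << f s >>.
Proof. exact: fgliftU. Qed.

Hypothesis f_inj : injective f.

Lemma coeff_push s c : coeff (f s) (push c) = coeff s c.
Proof.
apply: (@freeg_ext _ _ (coeff (f s) \o push) (coeff s)) => t _ /=.
by rewrite pushU !coeffU1 (inj_eq f_inj).
Qed.

Lemma push_inj : injective push.
Proof. by move=> c d cd; apply: freegP => s; rewrite -!coeff_push cd. Qed.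

End Push.

Lemma coeff_push_out (T U : choiceType) (f : T -> U) u c :
  (forall s, f s != u) -> coeff u (push f c) = 0.
Proof.
move=> h; apply: (@freeg_ext _ _ (coeff u \o push f) \0) => t _ /=.
by rewrite pushU coeffU1 (negbTE (h t)).
Qed.

(** * Chains of sequences, cones and links *)

(** Chains of all dimensions, including the empty simplex, live in one free
    group on sequences. This is the augmented complex, so reduced homology in
    degrees -1, 0 and above is treated uniformly. *)

Section SeqChains.
Context (T : choiceType).
Implicit Types (x y : T) (s t : seq T).
Local Notation chains := {freeg (seq T) / int}.

Fixpoint bd_seq s : chains :=
  if s is x :: s' then << s' >> - push (cons x) (bd_seq s') else 0.

Definition bd : chains -> chains := fglift bd_seq.
HB.instance Definition _ := GRing.Additive.on bd.

Definition cone x : chains -> chains := push (rcons^~ x).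
HB.instance Definition _ x := GRing.Additive.on (cone x).

(** The link of x for chains ordered with x last: it keeps the sequences that
    end in x and deletes this x. It is a left inverse of the cone. *)
Definition link_seq x s : chains :=
  if s is y :: s' then if last y s' == x then << belast y s' >> else 0 else 0.

Definition link x : chains -> chains := fglift (link_seq x).
HB.instance Definition _ x := GRing.Additive.on (link x).

Lemma bdU s : bd << s >> = bd_seq s. Proof. exact: fgliftU. Qed.
Lemma coneU x s : cone x << s >> = << rcons s x >>. Proof. exact: pushU. Qed.

Lemma linkU x s y : link x << rcons s y >> = if y == x then << s >> else 0.
Proof.
rewrite /link fgliftU; case: s => [|z s] //=.
by rewrite last_rcons belast_rcons.
Qed.

Lemma bd_cons x c : bd (push (cons x) c) = c - push (cons x) (bd c).
Proof.
apply: (@freeg_ext _ _ (bd \o push (cons x)) (idfun \- (push (cons x) \o bd))).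
by move=> s _ /=; rewrite pushU !bdU.
Qed.

Lemma bd_seq_rcons s x :
  bd_seq (rcons s x) = cone x (bd_seq s) + (-1) ^+ size s *: << s >>.
Proof.
elim: s => [|y s IH] /=; first by rewrite !raddf0 addr0 scale1r add0r.
rewrite IH raddfD raddfB /= coneU opprD addrA; congr (_ - _ + _); last first.
  by rewrite raddfZ_int /= pushU exprS mulN1r scaleNr.
apply: (@freeg_ext _ _ (push (cons y) \o cone x) (cone x \o push (cons y))).
by move=> t _ /=; rewrite coneU !pushU coneU.
Qed.

(** The exponent is the position of the apex, as the cone appends it at the
    end. *)
Lemma bd_cone x n c : c \in supported [set s | size s = n] ->
  bd (cone x c) = cone x (bd c) + (-1) ^+ n *: c.
Proof.
move=> /supportedP cn.
apply: (@freeg_ext _ _ (bd \o cone x)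
  ((cone x \o bd) \+ ( *:%R ((-1) ^+ n)))) => s /cn /= sn.
by rewrite coneU !bdU bd_seq_rcons sn.
Qed.

Lemma bd_seq_sub s : bd_seq s \in supported
  [set t | subseq t s /\ (size t).+1 = size s].
Proof.
elim: s => [|x s IH] /=; first exact: rpred0.
apply: rpredB; first by apply: supportedU; split=> //; exact: subseq_cons.
apply: supported_lift IH => t [ts <-]; apply: supportedU; split=> //=.
by rewrite eqxx.
Qed.

Lemma coeff_link x s c : coeff s (link x c) = coeff (rcons s x) c.
Proof.
apply: (@freeg_ext _ _ (coeff s \o link x) (coeff (rcons s x))) => t _ /=.
case/lastP: t => [|t y].
  rewrite /link fgliftU /= coeff0 coeffU1.
  by case: eqP => // /(congr1 size); rewrite size_rcons.
rewrite linkU !coeffU1 eqseq_rcons; case: (y == x); rewrite ?andbT ?andbF.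
  by rewrite coeffU1.
by rewrite coeff0.
Qed.

Lemma coeff_cone x s c : coeff (rcons s x) (cone x c) = coeff s c.
Proof. exact: (coeff_push (@rcons_injl _ x)). Qed.

Lemma coeff_cone_out x y s c : y != x -> coeff (rcons s y) (cone x c) = 0.
Proof.
move=> yx; apply: coeff_push_out => t; rewrite eqseq_rcons eq_sym.
by rewrite [x == y]eq_sym (negbTE yx) andbF.
Qed.

Lemma link_cone x c : link x (cone x c) = c.
Proof. by apply: freegP => s; rewrite coeff_link coeff_cone. Qed.

Lemma link_out x c : c \in supported [set s : seq T | x \notin s] -> link x c = 0.
Proof.
move=> /supportedP h; apply: freegP => s; rewrite coeff_link coeff0.
apply: coeff_outdom; apply/negP => /h /=.
by rewrite mem_rcons mem_head.
Qed.

(** Every chain is a cone over its link plus a chain without simplices that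
    end in x. *)
Lemma dom_unlinked x c s : s \in dom (c - cone x (link x c)) ->
  s \in dom c /\ forall s', s <> rcons s' x.
Proof.
rewrite !mem_dom coeffB; case/lastP: s => [|s y].
  rewrite (@coeff_push_out _ _ _ [::]) ?subr0; last first.
    by move=> s; apply/negP => /eqP/(congr1 size); rewrite size_rcons.
  by split=> // s' /(congr1 size); rewrite size_rcons.
have [->|yx] := eqVneq y x; first by rewrite coeff_cone coeff_link subrr eqxx.
rewrite coeff_cone_out // subr0; split=> // s' /rcons_inj[_ yx'].
by rewrite yx' eqxx in yx.
Qed.

Definition only_last x s := x \notin s \/ exists2 s', s = rcons s' x & x \notin s'.

Lemma bd_seq_notin x s : x \notin s -> bd_seq s \in supported [set t : seq T | x \notin t].
Proof.
move=> xs; apply: supported_sub (bd_seq_sub s) => t [ts _].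
by apply: contra xs; exact: mem_subseq.
Qed.

(** On sequences that end in x, the faces that keep the apex give the boundary
    of the link; deleting the apex, or starting from a sequence without x,
    leaves sequences without x, which the link kills. *)
Lemma link_bd x c : c \in supported (only_last x) ->
  link x (bd c) = bd (link x c).
Proof.
move=> /supportedP h; apply: (@freeg_ext _ _ (link x \o bd) (bd \o link x)).
move=> s /h /= [xs|[s' -> xs']]; rewrite bdU.
  rewrite !link_out ?raddf0 //; first exact: supportedU.
  exact: bd_seq_notin.
rewrite bd_seq_rcons raddfD /= link_cone linkU eqxx bdU.
by rewrite raddfZ_int /= link_out ?scaler0 ?addr0 //; exact: supportedU.
Qed.

End SeqChains.

(** * Cycles on the punctured principal ideals *)

Section OrderChains.
Context (disp : Order.disp_t) (P : porderType disp).
Implicit Types (x y z : P) (A B : set P) (s t : seq P) (k n : nat).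
Local Notation chains := {freeg (seq P) / int}.

Definition chain_seqs A k : set (seq P) :=
  [set s | [/\ size s = k, sorted <%O s & forall x, x \in s -> A x] ].

Definition chains_in A k : {pred chains} := supported (chain_seqs A k).

HB.instance Definition _ A k := GRing.ZmodClosed.on (chains_in A k).

Lemma chains_in_sub A B k c :
  A `<=` B -> c \in chains_in A k -> c \in chains_in B k.
Proof.
by move=> AB; apply: supported_sub => s [sk slt sA]; split=> // x /sA /AB.
Qed.

Lemma chains_in_size A k c :
  c \in chains_in A k -> c \in supported [set s | size s = k].
Proof. by apply: supported_sub => s []. Qed.

Lemma bd_chains_in A k c : c \in chains_in A k.+1 -> bd c \in chains_in A k.
Proof.
apply: supported_lift => s [sk slt sA].
apply: supported_sub (bd_seq_sub s) => t [ts].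
rewrite sk => -[tk]; split=> //; first exact: subseq_sorted lt_trans _ _ ts slt.
by move=> x /(mem_subseq ts) /sA.
Qed.

Lemma sorted_rconsP s x :
  sorted <%O (rcons s x) <-> sorted <%O s /\ forall y, y \in s -> (y < x)%O.
Proof.
rewrite !(sorted_pairwise lt_trans) pairwise_rcons.
by split=> [/andP[/allP h ->]|[-> h]]; [|rewrite andbT; apply/allP].
Qed.

Lemma cone_chains_in A B x k c : (forall y, A y -> (y < x)%O) ->
  A `<=` B -> B x -> c \in chains_in A k -> cone x c \in chains_in B k.+1.
Proof.
move=> Ax AB Bx; apply: supported_lift => s [sk slt sA].
apply: supportedU; split; first by rewrite size_rcons sk.
  by apply/sorted_rconsP; split=> // y /sA /Ax.
by move=> y; rewrite mem_rcons inE => /predU1P[->//|/sA/AB].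
Qed.

Lemma strict_downE x y : strict_down x y <-> (y < x)%O.
Proof.
rewrite /strict_down /down /= lt_neqAle.
by split=> [[-> /eqP->]//|/andP[/eqP]].
Qed.

Hypothesis Pgr : graded P.

(** Degrees increase strictly along a chain, so a chain embeds into the set of
    the numbers below n. *)
Lemma size_chain s n : sorted <%O s -> (forall x, x \in s -> degree x < n)%N ->
  (size s <= n)%N.
Proof.
move=> slt sn; rewrite -(size_map (@degree _ P)) -[leqRHS](size_iota 0).
apply: uniq_leq_size.
  apply: (sorted_uniq ltn_trans ltnn); apply: homo_sorted slt => x y.
  exact: degree_lt.
by move=> _ /mapP[x /sn xs ->]; rewrite mem_iota.
Qed.

(** The last element has degree at least the number of elements before it. *)
Lemma degree_last_chain s y n : sorted <%O (rcons s y) -> size s = n ->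
  (forall x, x \in rcons s y -> degree x <= n)%N -> degree y = n.
Proof.
move=> /sorted_rconsP[slt sy] <- sn; apply/eqP; rewrite eqn_leq sn ?mem_rcons ?mem_head //=.
by apply: size_chain => // x /sy; exact: degree_lt.
Qed.

Lemma chains_in_eq0 A n c : (forall x, A x -> degree x < n)%N ->
  c \in chains_in A n.+1 -> c = 0.
Proof.
move=> An cA; apply: supported0; apply: supported_sub cA => s [sn slt sA].
have := size_chain slt (fun x xs => An x (sA x xs)).
by rewrite sn ltnn.
Qed.

Lemma rcons_only_last s x : sorted <%O (rcons s x) -> x \notin s.
Proof.
by move=> /sorted_rconsP[_ h]; apply/negP => /h; rewrite ltxx.
Qed.

Lemma link_chains_in A x k c : c \in chains_in A k.+1 ->
  link x c \in chains_in [set y | A y /\ (y < x)%O] k.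
Proof.
move=> /supportedP h; apply/supportedP => s; rewrite mem_dom coeff_link -mem_dom.
move=> /h [/=]; rewrite size_rcons => -[sk] /sorted_rconsP[slt sx] sA.
split=> // y ys; split; last exact: sx.
by apply: sA; rewrite mem_rcons inE ys orbT.
Qed.

Lemma only_last_maximal A x s : sorted <%O s -> (forall y, y \in s -> A y) ->
  (forall y, A y -> ~ (x < y)%O) -> only_last x s.
Proof.
move=> slt sA xmax; have [|] := boolP (x \in s); last by left.
case/lastP: s slt sA => // s y slt sA; rewrite mem_rcons inE => /predU1P[->|xs].
  by right; exists s => //; exact: rcons_only_last.
have /sorted_rconsP[_ /(_ x xs) xy] := slt.
by case: (xmax y _ xy); apply: sA; rewrite mem_rcons mem_head.
Qed.

Lemma bd_link A x k c : (forall y, A y -> ~ (x < y)%O) ->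
  c \in chains_in A k -> link x (bd c) = bd (link x c).
Proof.
move=> xmax cA; apply: link_bd; apply: supported_sub cA => s [_ slt sA].
exact: only_last_maximal xmax.
Qed.

Lemma link_notin A x k c : ~ A x -> c \in chains_in A k -> link x c = 0.
Proof.
move=> nAx cA; apply: link_out; apply: supported_sub cA => s [_ _ sA] /=.
by apply/negP => /sA.
Qed.

(** Vanishing of reduced homology in all degrees: k is the number of vertices,
    so k = 0 says that A is nonempty and k = 1 that it is connected. *)
Definition acyclic A : Prop := forall k c,
  c \in chains_in A k -> bd c = 0 -> exists2 b, b \in chains_in A k.+1 & bd b = c.

(** These cycles form the reduced homology in dimension degree x - 1 of the order
    complex of the elements below x, a homology sphere if P is admissible. They are
    also the relative homology group of the pair that contributes the cell x. *)
Definition sphere_cycle x c : Prop :=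
  c \in chains_in (strict_down x) (degree x) /\ bd c = 0.

Hypothesis Pac : forall x y, is_maximal_element (strict_down x) y ->
  acyclic (strict_down x `\ y).

(** Reading the coefficient of one maximal chain t of the elements below x is an
    isomorphism from the group of sphere cycles of x to the integers.

    Let y be the last element of t and A the elements below x other than y.
    The link of y maps sphere cycles of x to sphere cycles of y, and the
    coefficient of t becomes the coefficient of t without y. A cycle with
    vanishing link is a cycle of A in the top dimension, hence zero because A
    is acyclic. Conversely a sphere cycle of y bounds in A; the cone with apex
    y over it, glued to such a filling, is a sphere cycle of x with the
    prescribed link. *)
Lemma sphere_cycle_coeff n x t : degree x = n -> size t = n ->
  sorted <%O t -> (forall y, y \in t -> (y < x)%O) ->
  (forall c, sphere_cycle x c -> coeff t c = 0 -> c = 0) /\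
  exists2 g, sphere_cycle x g & coeff t g = 1.
Proof.
elim: n => [|n IH] in x t *.
  move=> dx /size0nil -> _ _; split=> [c [+ _] c0|].
    rewrite dx => /supportedP h; apply: freegP => s; rewrite coeff0.
    have [/h [/size0nil -> _ _ //]|/coeff_outdom //] := boolP (s \in dom c).
  exists << [::] >>; last by rewrite coeffU1 eqxx.
  by split; [rewrite dx; apply: supportedU|rewrite bdU].
case/lastP: t => [//|t y] dx; rewrite size_rcons => -[tn] slt tx.
have yx : (y < x)%O by apply: tx; rewrite mem_rcons mem_head.
have dn z : (z < x)%O -> (degree z <= n)%N.
  by move=> /(degree_lt Pgr); rewrite dx.
have dy : degree y = n by apply: (degree_last_chain slt tn) => z /tx /dn.
have /sorted_rconsP[slt' ty] := slt.
have [inj_y [g [gF g0] g1]] := IH y t dy tn slt' ty.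
have ymax z : strict_down x z -> ~ (y < z)%O.
  by move=> /strict_downE/dn zn /(degree_lt Pgr); rewrite dy ltnNge zn.
have Aac := Pac (conj ((strict_downE x y).2 yx) ymax).
set A := strict_down x `\ y in Aac.
have An z : A z -> (degree z < n.+1)%N by move=> [/strict_downE/dn].
have yA : strict_down y `<=` A.
  move=> z /strict_downE zy; split; first exact/strict_downE/(lt_trans zy).
  by move=> zy'; rewrite zy' ltxx in zy.
rewrite dy in gF.
split=> [c [cF c0]|].
  rewrite dx in cF; rewrite -coeff_link => ty0.
  have link0 : link y c = 0.
    apply: inj_y ty0; split; last by rewrite -(bd_link ymax cF) c0 raddf0.
    rewrite dy; apply: chains_in_sub (link_chains_in y cF).
    by move=> z [_ zy]; apply/strict_downE.
  have cA : c \in chains_in A n.+1.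
    apply/supportedP => s sc; move/supportedP/(_ s sc): cF => [sn ssorted sx].
    have /dom_unlinked[_ nlast] : s \in dom (c - cone y (link y c)).
      by rewrite link0 raddf0 subr0.
    split=> // z zs; split; first exact: sx.
    have [ys|[s' /nlast//]] := only_last_maximal ssorted sx ymax.
    by move=> zy; rewrite -zy zs in ys.
  (* A filling of c would have more vertices than the degrees in A permit. *)
  have [b bA <-] := Aac _ _ cA c0.
  by rewrite (chains_in_eq0 An bA) raddf0.
have [a aA ag] := Aac _ _ (chains_in_sub yA gF) g0.
exists (cone y g - (-1) ^+ n *: a); last first.
  rewrite coeffB coeff_cone g1 coeffZ coeff_outdom ?mulr0 ?subr0 //.
  apply/negP => /(supportedP _ _ aA) [_ _ ty_A].
  by have [|_] := ty_A y; [rewrite mem_rcons mem_head|exact].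
split; last first.
  rewrite raddfB raddfZ_int /= (bd_cone _ (chains_in_size gF)) g0 raddf0 add0r.
  by rewrite ag subrr.
rewrite dx; apply: rpredB.
  apply: cone_chains_in gF => [z /strict_downE//| |]; last exact/strict_downE.
  by move=> z /yA [].
rewrite -[_ ^+ n]intz scaler_int rpredMz //.
by apply: chains_in_sub aA => z [].
Qed.

End OrderChains.

(** * Comparison with chains of tuples *)

Lemma freegUz (T : choiceType) k (s : T) :
  << k *g s >> = << s >> *~ k :> {freeg T / int}.
Proof. by rewrite freegU_mulz intz. Qed.

Section TupleChains.
Context (disp : Order.disp_t) (P : porderType disp).
Implicit Types (x y z : P) (A B : set P) (s t : seq P) (k n : nat).

Definition emb n : {freeg (n.-tuple P) / int} -> {freeg (seq P) / int} :=
  push (@tval n P).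
HB.instance Definition _ n := GRing.Additive.on (@emb n).

Lemma emb_inj n : injective (@emb n).
Proof. exact: (push_inj val_inj). Qed.

Lemma coeff_emb n (t : n.-tuple P) c : coeff (tval t) (emb c) = coeff t c.
Proof. exact: (coeff_push val_inj). Qed.

Lemma dom_embP n (c : {freeg (n.-tuple P) / int}) s : s \in dom (emb c) ->
  exists2 t, s = tval t & t \in dom c.
Proof.
rewrite mem_dom => cs; have [[t st]|none] := pselect (exists t : n.-tuple P, tval t = s).
  by exists t => //; rewrite mem_dom -coeff_emb st.
move: cs; rewrite coeff_push_out ?eqxx // => t.
by apply/eqP => ts; apply: none; exists t.
Qed.

Lemma emb_surj n c : c \in supported [set s | size s = n] ->
  exists c' : {freeg (n.-tuple P) / int}, emb c' = c.
Proof.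
move=> /supportedP cn; exists (fglift
  (fun s => if insub s is Some t then << (t : n.-tuple P) >> else 0) c).
apply: (@freeg_ext _ _ (@emb n \o fglift _) idfun) => s /cn /= sn.
by rewrite fgliftU insubT ?sn // => ps; rewrite [emb _]pushU.
Qed.

Lemma emb_simplicial A n (c : {freeg (n.+1.-tuple P) / int}) :
  (emb c \in chains_in A n.+1) = (c \in @simplicial_chains _ P A n).
Proof.
apply/supportedP/simplicial_chainsP => [h t tc|h s /dom_embP[t -> /h[]]].
  have /h[] // : tval t \in dom (emb c) by rewrite mem_dom coeff_emb -mem_dom.
by split=> //; rewrite size_tuple.
Qed.

Lemma bd_seq_sum s :
  bd_seq s = \sum_(i < size s) << (-1) ^+ i *g take i s ++ drop i.+1 s >>.
Proof.
elim: s => [|x s IH] /=; first by rewrite big_ord0.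
rewrite big_ord_recl /= expr0 drop0; congr (_ + _).
rewrite IH raddf_sum -sumrN; apply: eq_bigr => i _ /=.
by rewrite [in LHS]freegUz [in RHS]freegUz raddfMz /= pushU /bump /= add1n exprS mulN1r mulrNz.
Qed.

Lemma tval_face n (i : 'I_n.+2) (t : n.+2.-tuple P) :
  tval (face i t) = take i t ++ drop i.+1 t.
Proof.
have ti : (i < size t)%N by rewrite size_tuple.
pose x0 := tnth t ord0.
apply: (@eq_from_nth _ x0).
  by rewrite size_cat size_takel ?size_drop ?size_tuple ?(ltnW (ltn_ord i)) //; have := ltn_ord i; lia.
move=> j; rewrite size_tuple => jn.
rewrite -(tnth_nth x0 (face i t) (Ordinal jn)) tnth_mktuple (tnth_nth x0) /=.
rewrite nth_cat size_takel; last by exact: ltnW.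
rewrite /bump; case: ltnP => ij; first by rewrite nth_take // leqNgt ij.
by rewrite nth_drop; congr nth; lia.
Qed.

Lemma bd_emb n (c : {freeg (n.+2.-tuple P) / int}) :
  bd (emb c) = emb (boundary c).
Proof.
apply: (@freeg_ext _ _ (@bd P \o @emb n.+2) (@emb n.+1 \o @boundary _ P n)).
move=> t _ /=; rewrite [emb _]pushU bdU boundaryU bd_seq_sum raddf_sum size_tuple.
apply: eq_bigr => i _; rewrite -tval_face.
by rewrite [in LHS]freegUz [in RHS]freegUz raddfMz /= [emb _]pushU.
Qed.

(** Three cases by the number k of vertices. For k = 0 a vertex of A gives a
    cone. For k = 1 a path to a base point a gives, for every vertex x, a
    chain of edges with boundary x - a, and these fill every 0-chain of
    augmentation zero. For larger k the hypothesis on simplicial homology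
    applies. *)
Lemma acyclic_admissible A : A !=set0 -> complex_connected A ->
  (forall n, (0 < n)%N -> forall h : simplicial_homology A n, h = 0) ->
  acyclic A.
Proof.
case=> a Aa Aconn Ahom [|[|n]] c cA c0.
- exists (push (cons a) c).
    apply: supported_lift cA => s [/size0nil -> _ _]; apply: supportedU.
    by split=> // x; rewrite inE => /eqP ->.
  by rewrite bd_cons c0 raddf0 subr0.
- pose filling x b := b \in chains_in A 2 /\ bd b = << [:: x] >> - << [:: a] >>.
  have fill x : A x -> exists b, filling x b.
    move=> Ax; have [p [pp lp pA]] := Aconn a x Aa Ax.
    elim/last_ind: p => [|p y IH] /= in x Ax pp lp pA *.
      by exists 0; rewrite -lp /filling rpred0 raddf0 subrr.
    rewrite last_rcons in lp; rewrite -{}lp {x Ax}.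
    move: pp; rewrite rcons_path => /andP[pp cmp].
    set z := last a p in cmp.
    have zA : A z.
      rewrite /z; case/lastP: (p) pA => [//|q w] h; rewrite last_rcons.
      by apply: h; rewrite !(mem_rcons, inE) eqxx orbT.
    have yA : A y by apply: pA; rewrite mem_rcons mem_head.
    have [||b [bA bb]] := IH z zA pp => //.
      by move=> w wp; apply: pA; rewrite mem_rcons inE wp orbT.
    have edge u v : (u < v)%O -> A u -> A v ->
        << [:: u; v] >> \in chains_in A 2 /\
        bd << [:: u; v] >> = << [:: v] >> - << [:: u] >>.
      move=> uv Au Av; split; last first.
        by rewrite bdU /= [push _ 0]raddf0 subr0 pushU.
      apply: supportedU; split=> //=; first by rewrite uv.
      by move=> w; rewrite !inE => /orP[] /eqP ->.
    have [zy|yz|<-] := comparable_ltgtP cmp.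
    + have [eA eb] := edge _ _ zy zA yA.
      exists (b + << [:: z; y] >>); split; first exact: rpredD.
      by rewrite raddfD /= bb eb addrC addrA subrK.
    + have [eA eb] := edge _ _ yz yA zA.
      exists (b - << [:: y; z] >>); split; first exact: rpredB.
      by rewrite raddfB /= bb eb opprB addrC addrA subrK.
    + by exists b.
  pose fl x := if pselect (A x) is left Ax then projT1 (cid (fill x Ax)) else 0.
  have flP x : A x -> filling x (fl x).
    by rewrite /fl; case: pselect => // Ax _; case: cid.
  pose F s := if s is x :: _ then fl x else 0.
  exists (fglift F c).
    apply: supported_lift cA => -[|x [|y l]] [] // _ _ xA.
    by have [] := flP x (xA _ (mem_head _ _)).
  have cE : c = push (cons a) (bd c) + c by rewrite c0 raddf0 add0r.
  rewrite [RHS](_ : _ = c - push (cons a) (bd c)); last by rewrite c0 raddf0 subr0.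
  apply: (@freeg_ext _ _ (@bd P \o fglift F) (idfun \- (push (cons a) \o @bd P))).
  move=> s sc; move: cA => /supportedP/(_ s sc).
  case: s sc => [|x [|y l]] sc [] // _ _ xA /=.
  rewrite fgliftU bdU /= raddf0 subr0 pushU.
  by have [] := flP x (xA _ (mem_head _ _)).
- have [c' cc'] := emb_surj (chains_in_size cA).
  rewrite -cc' emb_simplicial in cA.
  have c'0 : boundary c' = 0 by apply: emb_inj; rewrite -bd_emb cc' c0 raddf0.
  have c'Z : c' \in @rel_cycles _ P A set0 n.+1.
    by apply/andP; rewrite c'0 rpred0.
  have := Ahom n.+1 isT (subquot_class _ (Subgroup c'Z)).
  rewrite -(raddf0 (subquot_class _)) => /subquot_classP /=.
  rewrite subr0 => /rel_boundariesP[b [d [bA d0 c'E]]].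
  have dd : d = 0.
    apply: supported0; apply: supported_sub (d0 : d \in supported _) => t [_ t0].
    exact: (t0 (tnth t ord0)) (mem_tnth _ _).
  exists (emb b); first by rewrite emb_simplicial.
  by rewrite bd_emb -cc' c'E dd addr0.
Qed.

End TupleChains.

(** * The cellular basis and its incidence numbers *)

(** A complex whose n-th group is free on the elements of degree n, with
    incidence numbers 1 or -1 on covering pairs and 0 elsewhere. This is all
    that discrete Morse theory needs. One group of coordinates serves all n;
    cell_coord_degree and cell_coord_elt cut out its part of degree n. The value of cell_elt on
    an element of another degree is arbitrary. *)
Record cell_basis (disp : Order.disp_t) (P : porderType disp)
    (K : chain_complex) := CellBasis {
  cell_elt : forall n, P -> K n;
  cell_coord : forall n, {additive K n -> {freeg P / int}};
  cell_coord_eq0 : forall n v, cell_coord n v = 0 -> v = 0;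
  cell_coord_degree : forall n v x, coeff x (cell_coord n v) != 0 -> degree x = n;
  cell_coord_elt : forall n x, degree x = n -> cell_coord n (cell_elt n x) = << x >>;
  cell_incidence : forall n x y, degree x = n.+1 -> covers x y ->
    coeff y (cell_coord n (diff K n (cell_elt n.+1 x))) \in [:: 1; -1];
  cell_incidence_covers : forall n x y, degree x = n.+1 ->
    coeff y (cell_coord n (diff K n (cell_elt n.+1 x))) != 0 -> covers x y
}.

Section Cellular.
Context (disp : Order.disp_t) (P : porderType disp).
Implicit Types (x y z : P) (s t : seq P) (k n : nat).
Hypothesis Padm : homologically_admissible P.

Let Pgr : graded P. Proof. by case: Padm. Qed.

Let Pac x y : is_maximal_element (strict_down x) y ->
  acyclic (strict_down x `\ y).
Proof.
by case: Padm => _ _ h /h[A0 Aconn Ahom]; exact: acyclic_admissible.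
Qed.

Definition flag_below x t : Prop :=
  [/\ size t = degree x, sorted <%O t & forall y, y \in t -> (y < x)%O].

Lemma flag_below_exists x : exists t, flag_below x t.
Proof.
move: {2}(degree x) (erefl (degree x)) => n; elim: n => [|n IH] in x *.
  by move=> dx; exists [::]; rewrite /flag_below dx.
move=> dx; have [y yx dy] := cover_below Pgr dx.
have [t [ts tlt ty]] := IH y dy.
exists (rcons t y); split.
- by rewrite size_rcons ts dy dx.
- by apply/sorted_rconsP.
- move=> z; rewrite mem_rcons inE => /predU1P[->//|/ty zy].
  exact: lt_trans zy yx.
Qed.

Definition flag x : seq P := projT1 (cid (flag_below_exists x)).

Lemma flagP x : flag_below x (flag x).
Proof. by rewrite /flag; case: cid. Qed.

Definition full_flag x := rcons (flag x) x.

Lemma full_flag_inj : injective full_flag.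
Proof. by move=> x y /rcons_inj[_]. Qed.

Lemma full_flag_below x y : covers x y -> flag_below x (full_flag y).
Proof.
move=> cxy; have [ts tlt ty] := flagP y; split.
- by rewrite size_rcons ts (degree_covers Pgr cxy).
- by apply/sorted_rconsP.
- case: cxy => yx _ z; rewrite mem_rcons inE => /predU1P[->//|/ty zy].
  exact: lt_trans zy yx.
Qed.

Lemma coeff_flag_eq0 x t c : flag_below x t -> sphere_cycle x c ->
  coeff t c = 0 -> c = 0.
Proof.
by move=> [ts tlt tx]; exact: (sphere_cycle_coeff Pgr Pac erefl ts tlt tx).1.
Qed.

Lemma fundamental_cycle_exists x :
  exists g, sphere_cycle x g /\ coeff (flag x) g = 1.
Proof.
have [ts tlt tx] := flagP x.
have [_ [g gZ g1]] := sphere_cycle_coeff Pgr Pac erefl ts tlt tx.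
by exists g.
Qed.

Definition fundamental_cycle x := projT1 (cid (fundamental_cycle_exists x)).

Lemma fundamental_cycleP x : sphere_cycle x (fundamental_cycle x).
Proof. by rewrite /fundamental_cycle; case: cid => ? []. Qed.

Lemma fundamental_cycle_flag x : coeff (flag x) (fundamental_cycle x) = 1.
Proof. by rewrite /fundamental_cycle; case: cid => ? []. Qed.

(** Two maximal chains of the same ideal give two isomorphisms to the integers,
    which differ by a unit. *)
Lemma fundamental_cycle_unit x t : flag_below x t ->
  coeff t (fundamental_cycle x) \in [:: 1; -1].
Proof.
move=> tx; have [ts tlt tlx] := tx.
have [_ [g [gF g0] g1]] := sphere_cycle_coeff Pgr Pac erefl ts tlt tlx.
have [fF f0] := fundamental_cycleP x.
set f := fundamental_cycle x in fF f0 *.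
have : g - coeff (flag x) g *: f = 0.
  apply: (coeff_flag_eq0 (flagP x)).
    split; first by rewrite rpredB // -[coeff _ _]intz scaler_int rpredMz.
    by rewrite raddfB raddfZ_int /= g0 f0 scaler0 subrr.
  by rewrite coeffB coeffZ fundamental_cycle_flag mulr1 subrr.
move=> /(congr1 (coeff t)); rewrite coeffB coeffZ coeff0 g1 => /eqP.
rewrite subr_eq0 => /eqP/esym; set a := coeff _ g; set b := coeff t f.
by move=> /intUnitRing.unitzPl; rewrite qualifE !inE.
Qed.

Local Notation K := (cellular_complex P).

(** Degrees bound the length of chains: the skeleton of degrees at most n has no
    simplex of dimension n + 1, and the smaller one none of dimension n. So
    the relative homology group is the group of relative cycles itself. *)
Lemma rel_boundaries_skeleton n c :
  c \in @rel_boundaries _ P (skeleton n.+1) (skeleton n) n -> c = 0.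
Proof.
move=> /rel_boundariesP[b [a [bA aA ->]]].
have -> : b = 0.
  by apply/emb_inj; rewrite raddf0; apply: (@chains_in_eq0 _ _ Pgr (skeleton n.+1) n.+1) => //; rewrite emb_simplicial.
have -> : a = 0.
  by apply/emb_inj; rewrite raddf0; apply: (@chains_in_eq0 _ _ Pgr (skeleton n) n) => //; rewrite emb_simplicial.
by rewrite raddf0 addr0.
Qed.

Definition chain_of n (q : K n) : {freeg (seq P) / int} :=
  emb (val (repr (q : subquot _ _))).

Lemma chain_of_class n
    (c : subgroup (@rel_cycles _ P (skeleton n.+1) (skeleton n) n)) :
  chain_of (subquot_class _ c : K n) = emb (val c).
Proof.
congr emb; apply/eqP; rewrite -subr_eq0; apply/eqP/rel_boundaries_skeleton.
by apply/subquot_classP; rewrite subquot_classK.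
Qed.

Lemma chain_of_is_additive n : zmod_morphism (@chain_of n).
Proof.
move=> p q; rewrite -[p]subquot_classK -[q]subquot_classK -raddfB.
by rewrite !chain_of_class !raddfB.
Qed.
HB.instance Definition _ n :=
  GRing.isZmodMorphism.Build (K n) {freeg (seq P) / int} (@chain_of n)
    (@chain_of_is_additive n).

Lemma chain_of_eq0 n (q : K n) : chain_of q = 0 -> q = 0.
Proof.
rewrite -(raddf0 (@emb _ P n.+1)) => /emb_inj q0.
rewrite -[q]subquot_classK -(raddf0 (subquot_class _)); apply/subquot_classP.
by rewrite q0 sub0r rpredN raddf0 rpred0.
Qed.

Lemma chain_of_in n (q : K n) : chain_of q \in chains_in (skeleton n.+1) n.+1.
Proof.
rewrite /chain_of emb_simplicial; have := subgroup_valP (repr (q : subquot _ _)).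
by case: n q => [|n] q // /andP[].
Qed.

Lemma bd_chain_of_in n (q : K n) : bd (chain_of q) \in chains_in (skeleton n) n.
Proof.
have := chain_of_in q; have := subgroup_valP (repr (q : subquot _ _)).
case: n q => [|n] q /= h hq.
  apply: supported_sub (bd_chains_in hq) => s [/size0nil -> _ _].
  by split.
by rewrite bd_emb emb_simplicial; case/andP: h.
Qed.

Lemma chain_of_surj n c : c \in chains_in (skeleton n.+1) n.+1 ->
  bd c \in chains_in (skeleton n) n -> exists q : K n, chain_of q = c.
Proof.
move=> cA bA; have [c' cc'] := emb_surj (chains_in_size cA).
suff c'Z : c' \in @rel_cycles _ P (skeleton n.+1) (skeleton n) n.
  by exists (subquot_class _ (Subgroup c'Z)); rewrite chain_of_class.
rewrite -cc' emb_simplicial in cA.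
case: n c' cc' cA bA => [//|n] c' cc' cA bA; apply/andP; split=> //.
by rewrite -emb_simplicial -bd_emb cc'.
Qed.

Lemma chain_of_diff n (q : K n.+1) : chain_of (diff K n q) = bd (chain_of q).
Proof.
rewrite -[q]subquot_classK [diff _ _ _]connecting_class !chain_of_class /=.
by rewrite -bd_emb.
Qed.

Lemma flag_coord_exists : exists h : seq P -> {freeg P / int},
  forall s x, coeff x (h s) = (s == full_flag x)%:R.
Proof.
suff /choice[h hE] : forall s, exists d : {freeg P / int},
    forall x, coeff x d = (s == full_flag x)%:R by exists h.
move=> s; have [[x ->]|none] := pselect (exists x, s = full_flag x).
  by exists << x >> => y; rewrite coeffU1 (inj_eq full_flag_inj).
exists 0 => x; rewrite coeff0; case: eqP => // sx.
by case: none; exists x.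
Qed.

(** The link of x turns a relative cycle into a sphere cycle of x, whose
    coefficient at the chosen flag of x is the coordinate. The basis element
    of x is the cone over the fundamental cycle g of x. Its boundary is g up
    to sign, so the incidence number of x and y is the coefficient in g of a
    maximal chain of the ideal of x when x covers y. *)
Lemma cellular_cell_basis : cell_basis P K.
Proof.
have [h hE] := cid flag_coord_exists.
pose co n : {additive K n -> {freeg P / int}} := (fglift h \o @chain_of n).
have coE n (q : K n) x : coeff x (co n q) = coeff (full_flag x) (chain_of q).
  apply: (@freeg_ext _ _ (coeff x \o fglift h) (coeff (full_flag x))) => s _ /=.
  by rewrite fgliftU hE coeffU1.
have linkP n (q : K n) x : degree x = n -> sphere_cycle x (link x (chain_of q)).
  move=> dx; have xmax y : skeleton n.+1 y -> ~ (x < y)%O.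
    by rewrite /skeleton /= ltnS => dy /(degree_lt Pgr); rewrite dx ltnNge dy.
  split.
    rewrite dx; apply: chains_in_sub (link_chains_in x (chain_of_in q)).
    by move=> y [_ yx]; apply/strict_downE.
  rewrite -(bd_link xmax (chain_of_in q)); apply: link_notin (bd_chain_of_in q).
  by rewrite /skeleton /= dx ltnn.
have inj n (q : K n) : co n q = 0 -> q = 0.
  move=> q0; apply: chain_of_eq0; apply: freegP => s; rewrite coeff0.
  have [|/coeff_outdom//] := boolP (s \in dom (chain_of q)).
  move=> /(supportedP _ _ (chain_of_in q)) [ssz slt sd].
  case/lastP: s => [//|s x] in ssz slt sd *; rewrite size_rcons in ssz.
  case: ssz => ssz; have dx : degree x = n.
    by apply: (degree_last_chain Pgr slt ssz) => y /sd.
  rewrite -coeff_link (coeff_flag_eq0 (flagP x) (linkP n q x dx)) ?coeff0 //.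
  by rewrite coeff_link -coE q0 coeff0.
have deg_co n (q : K n) x : coeff x (co n q) != 0 -> degree x = n.
  rewrite coE -mem_dom => /(supportedP _ _ (chain_of_in q)) [ssz slt sd].
  apply: (degree_last_chain Pgr slt); last by move=> y /sd.
  by move: ssz; rewrite size_rcons => -[].
have elts n x : degree x = n -> exists q : K n, chain_of q = cone x (fundamental_cycle x).
  move=> dx; have [gF g0] := fundamental_cycleP x; rewrite dx in gF.
  have down_sk y : strict_down x y -> skeleton n y.
    by move=> /strict_downE/(degree_lt Pgr); rewrite dx.
  apply: chain_of_surj.
    apply: cone_chains_in gF => [y /strict_downE//|y /down_sk|].
      by rewrite /skeleton /= => /ltnW.
    by rewrite /skeleton /= dx.
  rewrite (bd_cone _ (chains_in_size gF)) g0 raddf0 add0r.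
  rewrite -[_ ^+ n]intz scaler_int rpredMz //.
  exact: chains_in_sub gF.
pose el n x : K n := if pselect (degree x = n) is left dx then projT1 (cid (elts n x dx)) else 0.
have elE n x : degree x = n -> chain_of (el n x) = cone x (fundamental_cycle x).
  by rewrite /el; case: pselect => // dx _; case: cid.
have del n x y : degree x = n.+1 -> coeff y (co n (diff K n (el n.+1 x))) =
    (-1) ^+ n.+1 * coeff (full_flag y) (fundamental_cycle x).
  move=> dx; have [gF g0] := fundamental_cycleP x; rewrite dx in gF.
  rewrite coE chain_of_diff elE // (bd_cone _ (chains_in_size gF)) g0 raddf0 add0r.
  by rewrite coeffZ.
exists el co => // [n x dx|n x y dx cxy|n x y dx].
- apply: freegP => y; rewrite coE elE // coeffU1; have [<-|xy] := eqVneq x y.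
    by rewrite coeff_cone fundamental_cycle_flag.
  by rewrite coeff_cone_out // eq_sym.
- rewrite del //; have := fundamental_cycle_unit (full_flag_below cxy).
  rewrite !inE => /pred2P[] ->; rewrite -signr_odd.
    by case: odd.
  by case: odd.
- rewrite del // => nz; have : full_flag y \in dom (fundamental_cycle x).
    by rewrite mem_dom; apply: contraNneq nz => ->; rewrite mulr0.
  have [gF _] := fundamental_cycleP x.
  move=> /(supportedP _ _ gF) [ssz _ sd].
  have yx : (y < x)%O.
    by apply/strict_downE/sd; rewrite mem_rcons mem_head.
  apply: (lt_degree_covers Pgr yx).
  by have [<- _ _] := flagP y; rewrite -ssz size_rcons.
Qed.

End Cellular.

(** * Quotients by acyclic subcomplexes *)

Lemma group_isomorphic_sym (V W : zmodType) :
  group_isomorphic V W -> group_isomorphic W V.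
Proof.
case=> f [g fK gK].
have gB : zmod_morphism g by move=> x y; apply: (can_inj fK); rewrite raddfB !gK.
pose gA := GRing.isZmodMorphism.Build W V g gB.
exists (HB.pack_for {additive W -> V} g gA).
by exists f.
Qed.

(** The kernel of pi is an acyclic subcomplex and sigma splits pi in each degree
    (it need not be a chain map), so K and its quotient by the kernel have the
    same homology. *)
Section Retract.
Context (K : chain_complex) (M : nat -> zmodType).
Context (pi : forall n, {additive K n -> M n}).
Context (sigma : forall n, {additive M n -> K n}).
Hypothesis sigmaK : forall n m, pi n (sigma n m) = m.
Hypothesis ker_diff : forall n v, pi n.+1 v = 0 -> pi n (diff K n v) = 0.
Hypothesis ker_acyclic : forall n v, pi n v = 0 -> v \in cycles K n ->
  exists2 w, pi n.+1 w = 0 & v = diff K n w.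

Definition quotient_diff n : {additive M n.+1 -> M n} :=
  (pi n \o diff K n) \o sigma n.+1.

Lemma pi_diff n v : pi n (diff K n v) = quotient_diff n (pi n.+1 v).
Proof.
apply/eqP; rewrite -subr_eq0 /= -!raddfB; apply/eqP/ker_diff.
by rewrite raddfB sigmaK subrr.
Qed.

Lemma quotient_diff_diff n c : quotient_diff n (quotient_diff n.+1 c) = 0.
Proof. by rewrite -[c]sigmaK -!pi_diff diff_diff raddf0. Qed.

Definition quotient_complex := ChainComplex quotient_diff_diff.

Lemma pi_cycles n z : z \in cycles K n -> pi n z \in cycles quotient_complex n.
Proof.
case: n z => [//|n] z; rewrite !inE => /eqP z0.
by rewrite /= -[pi n (diff _ _ _)]/(quotient_diff n (pi n.+1 z)) -pi_diff z0 raddf0.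
Qed.

Lemma pi_boundaries n z : z \in cycles K n -> z \in boundaries K n ->
  pi n z \in boundaries quotient_complex n.
Proof.
move=> _ /boundariesP[b ->]; apply/boundariesP.
by exists (pi n.+1 b); rewrite pi_diff.
Qed.

Lemma diff_cycles n (c : K n.+1) : diff K n c \in cycles K n.
Proof. by case: n c => [//|n] c; rewrite inE diff_diff. Qed.

Lemma lift_cycle n (m : M n) : m \in cycles quotient_complex n ->
  exists2 z, z \in cycles K n & pi n z = m.
Proof.
case: n m => [|n] m; first by exists (sigma 0%N m); rewrite ?sigmaK.
rewrite inE => /eqP m0.
have [w w0 wE] := ker_acyclic (m0 : pi n _ = 0) (diff_cycles _).
exists (sigma n.+1 m - w); last by rewrite raddfB sigmaK w0 subr0.
by rewrite inE raddfB -wE subrr.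
Qed.

Lemma quotient_homology n :
  group_isomorphic (homology quotient_complex n) (homology K n).
Proof.
apply: group_isomorphic_sym.
pose f := subquot_map (@pi_cycles n) (@pi_boundaries n).
suff [f_inj /choice[g fg]] : injective f /\ forall q, exists p, f p = q.
  by exists f, g => // p; apply: f_inj; rewrite fg.
split=> [p q|q].
  rewrite -[p]subquot_classK -[q]subquot_classK !subquot_map_class.
  set u := repr p; set v := repr q => /subquot_classP /=.
  rewrite -raddfB => /boundariesP[b bE]; apply/subquot_classP.
  have k0 : pi n (val u - val v - diff K n (sigma n.+1 b)) = 0.
    by rewrite raddfB pi_diff sigmaK bE subrr.
  have [|w _ wE] := ker_acyclic k0.
    by rewrite !rpredB ?subgroup_valP ?diff_cycles.
  apply/boundariesP; exists (w + sigma n.+1 b).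
  by rewrite raddfD -wE subrK.
rewrite -[q]subquot_classK; set m := repr q.
have [z zZ zE] := lift_cycle (subgroup_valP m).
exists (subquot_class _ (Subgroup zZ)); rewrite subquot_map_class.
by congr subquot_class; apply: val_inj.
Qed.

End Retract.

(** * Morse matchings without rays *)

(** A relation without infinite walks is well founded in the direction of its
    arrows. *)
Lemma walk_ind (T : Type) (e : rel T) (Q : T -> Prop) :
  (forall w : nat -> T, ~ forall i, e (w i) (w i.+1)) ->
  (forall x, (forall y, e x y -> Q y) -> Q x) -> forall x, Q x.
Proof.
move=> nowalk IH x; apply: contrapT => nQx.
have /choice[f fP] y : exists z, ~ Q y -> e y z /\ ~ Q z.
  have [Qy|nQy] := pselect (Q y); first by exists y.
  apply: contrapT => none; apply: nQy; apply: IH => z yz.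
  by apply: contrapT => nQz; apply: none; exists z.
have nQ i : ~ Q (iter i f x) by elim: i => //= i /fP[].
by apply: (nowalk (fun i => iter i f x)) => i; have [] := fP _ (nQ i).
Qed.

Lemma finite_maximal (T : eqType) (R : T -> T -> Prop) (s : seq T) :
  (forall x, ~ R x x) -> (forall x y z, R x y -> R y z -> R x z) ->
  s != [::] -> exists2 x, x \in s & forall y, y \in s -> ~ R y x.
Proof.
move=> irr tr; elim: s => // x [|x' s] IH _.
  by exists x; rewrite ?mem_head // => y; rewrite inE => /eqP ->; exact: irr.
have [//|y ys ymax] := IH.
have [xy|nxy] := pselect (R x y).
  exists x; rewrite ?mem_head // => z; rewrite inE => /predU1P[->|/ymax nzy zx].
    exact: irr.
  by apply: nzy; exact: tr zx xy.
exists y; first by rewrite inE ys orbT.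
by move=> z; rewrite inE => /predU1P[->|/ymax].
Qed.

Section Morse.
Context (disp : Order.disp_t) (P : porderType disp).
Implicit Types (x y z u : P) (n : nat).
Context (K : chain_complex) (b : cell_basis P K) (M : set (P * P)).
Hypothesis Pgr : graded P.
Hypothesis Mmorse : morse_matching M.
Hypothesis nowalk : forall w : nat -> P, ~ forall i, hasse_arrow M (w i) (w i.+1).

Context (I : nat -> choiceType) (beta : forall n, I n -> P).
Hypothesis beta_inj : forall n, injective (@beta n).
Hypothesis beta_critical : forall n x,
  critical_degree M n x <-> exists i : I n, beta i = x.

Local Notation elt := (@cell_elt _ _ _ b _).
Local Notation co := (@cell_coord _ _ _ b _).
Local Notation arrow := (hasse_arrow M).

Definition upper x := exists y, M (x, y).
Definition lower y := exists x, M (x, y).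

Lemma M_covers x y : M (x, y) -> covers x y.
Proof. by case: Mmorse => -[h _] _; exact: h. Qed.

Lemma M_degree x y : M (x, y) -> degree x = (degree y).+1.
Proof. by move=> /M_covers/(degree_covers Pgr). Qed.

Lemma M_disjoint x y x' y' : M (x, y) -> M (x', y') ->
  [\/ x = x', x = y', y = x' | y = y'] -> (x, y) = (x', y').
Proof. by case: Mmorse => -[_ h] _; exact: h. Qed.

Lemma upper_lower x : upper x -> lower x -> False.
Proof.
move=> [y xy] [u ux]; have [_ yx] : (x, y) = (u, x) by apply: (M_disjoint xy ux); constructor 2.
by have := M_degree xy; rewrite yx; lia.
Qed.

Lemma critical_upper x : critical M x -> ~ upper x.
Proof. by move=> h [y xy]; have [] := h y. Qed.

Lemma critical_lower x : critical M x -> ~ lower x.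
Proof. by move=> h [y xy]; have [] := h y. Qed.

Lemma cell_trichotomy x : [\/ critical M x, upper x | lower x].
Proof.
have [|nu] := pselect (upper x); first by constructor 2.
have [|nl] := pselect (lower x); first by constructor 3.
constructor 1 => y; split=> h; [apply: nu|apply: nl]; by exists y.
Qed.

Lemma arrow_up x u : M (u, x) -> arrow x u.
Proof. by move=> ux; apply/asboolP; right. Qed.

Lemma arrow_down x y : covers x y -> ~ M (x, y) -> arrow x y.
Proof. by move=> xy nM; apply/asboolP; left. Qed.

Lemma cell_coord_inj n : injective (@cell_coord _ _ _ b n).
Proof.
move=> v w vw; apply/eqP; rewrite -subr_eq0; apply/eqP/(cell_coord_eq0 (c := b)).
by rewrite raddfB vw subrr.
Qed.

Lemma cell_sum n (v : K n) : v = \sum_(x <- dom (co v)) elt x *~ coeff x (co v).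
Proof.
apply: cell_coord_inj; rewrite raddf_sum {1}[co v]freeg_sumMz !big_seq.
apply: eq_bigr => x; rewrite mem_dom => /cell_coord_degree dx.
by rewrite raddfMz /= cell_coord_elt.
Qed.

Definition upper_part n : {pred K n} :=
  [pred v | co v \in supported upper].

Lemma upper_partE n (v : K n) :
  (v \in @upper_part n) = (co v \in supported upper).
Proof. by []. Qed.

Lemma upper_part_zmod_closed n : zmod_closed (@upper_part n).
Proof.
split=> [|v w]; rewrite !upper_partE ?raddf0 ?rpred0 // raddfB => hv hw.
exact: rpredB.
Qed.
HB.instance Definition _ n :=
  GRing.isZmodClosed.Build (K n) (@upper_part n) (@upper_part_zmod_closed n).

Lemma coeff_upper_part n (v : K n) x : v \in @upper_part n -> ~ upper x ->
  coeff x (co v) = 0.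
Proof.
move=> /supportedP h nu; apply/eqP/negPn; rewrite -mem_dom; apply/negP.
by move=> /h.
Qed.

(** For a Morse matching this is a strict order, so a finite set of vertices has
    an element that no other one reaches. *)
Definition reaches x y := exists p, path arrow x (rcons p y).

Lemma reaches_irr x : ~ reaches x x.
Proof.
case=> p xp; case: Mmorse => _ /(_ (x :: p)) h.
by move: (h isT); rewrite /cycle xp.
Qed.

Lemma reaches_trans x y z : reaches x y -> reaches y z -> reaches x z.
Proof.
move=> [p xp] [q yq]; exists (rcons p y ++ q).
by rewrite rcons_cat cat_path xp last_rcons.
Qed.

(** On the span of the upper elements the differential stays injective after
    projection to the span of the lower ones. Take u in the support of v that
    no other element of the support reaches, and its partner w. Any other
    element of the support that covers w would reach u through w, so the
    coefficient of w in d v is that of u in v up to sign. *)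
Lemma diff_upper_inj n (v : K n.+1) : v \in @upper_part n.+1 ->
  (forall y, lower y -> coeff y (co (diff K n v)) = 0) -> v = 0.
Proof.
move=> vU v0; apply/(cell_coord_eq0 (c := b))/eqP/negPn/negP.
rewrite -dom_eq0 => /(finite_maximal reaches_irr reaches_trans)[u ud umax].
have [w uw] : upper u by move/supportedP: vU; apply.
have dd x : x \in dom (co v) -> degree x = n.+1.
  by rewrite mem_dom => /cell_coord_degree.
have := v0 w (ex_intro _ u uw); rewrite {1}[v]cell_sum !raddf_sum.
rewrite (bigD1_seq u) ?uniq_dom //= big1_seq ?addr0.
  rewrite !raddfMz /= => /eqP; rewrite -mulrzr mulf_eq0 intz.
  apply/negP; rewrite negb_or -(mem_dom (co v)) ud andbT.
  have := cell_incidence b (dd u ud) (M_covers uw).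
  by rewrite !inE => /pred2P[] ->.
move=> x /andP[xu xd]; rewrite !raddfMz /=.
suff -> : coeff w (co (diff K n (elt x))) = 0 by rewrite mul0rz.
apply/eqP/negPn/negP => /(cell_incidence_covers (dd x xd)) xw.
case: (umax x xd); exists [:: w]; rewrite /= (arrow_up uw) !andbT.
apply: arrow_down => // Mxw.
have [xu'] : (x, w) = (u, w) by apply: (M_disjoint Mxw uw); constructor 4.
by rewrite xu' eqxx in xu.
Qed.

(** The subcomplex generated by the upper elements. It is acyclic, and the
    critical elements span a complement in each degree. *)
Definition matched_part n : {pred K n} :=
  [pred v | `[< exists d d', [/\ d \in @upper_part n, d' \in @upper_part n.+1 &
                 v = d + diff K n d'] >] ].

Lemma matched_partP n v : reflect
  (exists d d', [/\ d \in @upper_part n, d' \in @upper_part n.+1 &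
                 v = d + diff K n d']) (v \in @matched_part n).
Proof. exact: asboolP. Qed.

Lemma matched_part_zmod_closed n : zmod_closed (@matched_part n).
Proof.
split=> [|v w /matched_partP[d [d' [dU dU' ->]]] /matched_partP[c [c' [cU cU' ->]]]].
  by apply/matched_partP; exists 0, 0; rewrite !rpred0 raddf0 addr0.
apply/matched_partP; exists (d - c), (d' - c'); rewrite !rpredB //; split=> //.
by rewrite raddfB opprD addrACA.
Qed.
HB.instance Definition _ n :=
  GRing.isZmodClosed.Build (K n) (@matched_part n) (@matched_part_zmod_closed n).

Definition sigma_fun n (a : {freeg (I n) / int}) : K n :=
  fglift (fun i => elt (beta i) : zmodule (K n)) a.

Lemma sigma_is_additive n : zmod_morphism (@sigma_fun n).
Proof. exact: (@lift_is_additive int (I n) (zmodule (K n)) _). Qed.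

HB.instance Definition _ n :=
  GRing.isZmodMorphism.Build {freeg (I n) / int} (K n) (@sigma_fun n)
    (@sigma_is_additive n).

Definition sigma n : {additive {freeg (I n) / int} -> K n} := @sigma_fun n.

Lemma sigmaU n (i : I n) : sigma n << i >> = elt (beta i).
Proof. exact: (@fgliftU (I n) (zmodule (K n)) (fun j => elt (beta j)) i). Qed.

Lemma beta_in n (i : I n) : critical M (beta i) /\ degree (beta i) = n.
Proof. by have [|] := (beta_critical n (beta i)).2; first by exists i. Qed.

Lemma co_sigma n (a : {freeg (I n) / int}) : co (sigma n a) = push (@beta n) a.
Proof.
apply: (@freeg_ext _ _ (@cell_coord _ _ _ b n \o sigma n) (push (@beta n))) => i _.
by rewrite /= pushU sigmaU cell_coord_elt //; case: (beta_in i).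
Qed.

(** Write sigma a = d + diff d'. Lower elements occur neither in sigma a nor in
    d, so diff_upper_inj gives d' = 0; then nothing critical occurs in d. *)
Lemma sigma_matched_eq0 n a : sigma n a \in @matched_part n -> a = 0.
Proof.
move=> /matched_partP[d [d' [dU dU' aE]]].
have d'0 : d' = 0.
  apply: diff_upper_inj => // y yl.
  have -> : diff K n d' = sigma n a - d by rewrite aE addrC addKr.
  rewrite raddfB /= coeffB (coeff_upper_part dU) => [|/upper_lower/(_ yl)//].
  rewrite co_sigma coeff_push_out ?subrr // => i; apply/eqP => iy.
  by have [/critical_lower] := beta_in i; rewrite iy.
apply: freegP => i; rewrite coeff0 -(coeff_push (@beta_inj n)) -co_sigma aE.
rewrite d'0 raddf0 addr0 (coeff_upper_part dU) //.
by have [/critical_upper] := beta_in i.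
Qed.

Definition decomposable n : {pred K n} :=
  [pred v | `[< exists a, v - sigma n a \in @matched_part n >] ].

Lemma decomposable_zmod_closed n : zmod_closed (@decomposable n).
Proof.
split=> [|v w /asboolP[a va] /asboolP[c wc]]; apply/asboolP.
  by exists 0; rewrite raddf0 subr0 rpred0.
by exists (a - c); rewrite raddfB opprD addrACA -opprD rpredB.
Qed.
HB.instance Definition _ n :=
  GRing.isZmodClosed.Build (K n) (@decomposable n) (@decomposable_zmod_closed n).

Lemma matched_decomposable n v : v \in @matched_part n -> v \in @decomposable n.
Proof. by move=> vm; apply/asboolP; exists 0; rewrite raddf0 subr0. Qed.

Lemma elt_upper n x : degree x = n -> upper x -> cell_elt b n x \in @upper_part n.
Proof. by move=> dx xu; rewrite upper_partE cell_coord_elt //; exact: supportedU. Qed.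

(** The only case that uses induction is that of a lower element x with partner
    u. The boundary of u lies in the matched part and contains x with
    coefficient 1 or -1; its other elements are reached from x by two arrows,
    up to u and down. Hence the induction carries the successors along. *)
Lemma elt_decomposable x : forall n, degree x = n -> cell_elt b n x \in @decomposable n.
Proof.
pose Q x := forall n, degree x = n -> cell_elt b n x \in @decomposable n.
suff [] : Q x /\ forall y, arrow x y -> Q y by [].
move: x; apply: (walk_ind nowalk) => x IH; split=> [n dx|y /IH[]//].
have [xc|xu|[u ux]] := cell_trichotomy x.
- have [i ix] := (beta_critical n x).1 (conj xc dx).
  by apply/asboolP; exists << i >>; rewrite sigmaU ix subrr rpred0.
- apply: matched_decomposable; apply/matched_partP.
  by exists (elt x), 0; rewrite raddf0 addr0 rpred0 elt_upper.
have [_ IHu] := IH u (arrow_up ux).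
have du : degree u = n.+1 by rewrite (M_degree ux) dx.
set w := diff K n (elt u).
have wD : w \in @decomposable n.
  apply: matched_decomposable; apply/matched_partP; exists 0, (elt u).
  by rewrite rpred0 add0r elt_upper //; exists x.
have : elt x *~ coeff x (co w) \in @decomposable n.
  rewrite -[X in X \in _](addrNK w) -opprB rpredD // rpredN.
  rewrite {1}[w]cell_sum; have xw : x \in dom (co w).
    rewrite mem_dom; have := cell_incidence b du (M_covers ux).
    by rewrite !inE => /pred2P[] ->.
  rewrite (bigD1_seq x) ?uniq_dom //= addrAC subrr add0r big_seq_cond.
  apply: rpred_sum => y /andP[yw yx]; apply: rpredMz; apply: IHu.
    apply: arrow_down; first by apply: (cell_incidence_covers (c := b) du); rewrite -mem_dom.
    move=> Muy; have [yx'] : (u, y) = (u, x).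
      by apply: (M_disjoint Muy ux); constructor 1.
    by rewrite yx' eqxx in yx.
  by move: yw; rewrite mem_dom => /cell_coord_degree.
have := cell_incidence b du (M_covers ux); rewrite -/w in_cons mem_seq1 => /pred2P[] ->.
  by rewrite mulr1z.
by rewrite mulrNz mulr1z rpredN.
Qed.

Lemma decomposition n (v : K n) : exists a, v - sigma n a \in @matched_part n.
Proof.
apply/asboolP; rewrite -[asbool _]/(v \in @decomposable n) [v]cell_sum big_seq.
apply: rpred_sum => x; rewrite mem_dom => /cell_coord_degree dx.
by apply: rpredMz; exact: elt_decomposable.
Qed.

Definition pi_fun n (v : K n) : {freeg (I n) / int} :=
  projT1 (cid (decomposition v)).

Lemma pi_funP n (v : K n) : v - sigma n (pi_fun v) \in @matched_part n.
Proof. by rewrite /pi_fun; case: cid. Qed.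

Lemma pi_fun_eq n (v : K n) a : v - sigma n a \in @matched_part n -> pi_fun v = a.
Proof.
move=> va; apply/eqP; rewrite -subr_eq0; apply/eqP/sigma_matched_eq0.
have := rpredB va (pi_funP v).
by rewrite opprB addrC subrKA raddfB.
Qed.

Lemma pi_is_additive n : zmod_morphism (@pi_fun n).
Proof.
move=> v w; apply: pi_fun_eq.
by rewrite raddfB opprD addrACA -opprD rpredB ?pi_funP.
Qed.
HB.instance Definition _ n :=
  GRing.isZmodMorphism.Build (K n) {freeg (I n) / int} (@pi_fun n)
    (@pi_is_additive n).

Definition pi n : {additive K n -> {freeg (I n) / int}} := @pi_fun n.

Lemma pi_eq0 n v : (pi n v = 0) <-> (v \in @matched_part n).
Proof.
split=> [v0|vm]; last by apply: pi_fun_eq; rewrite raddf0 subr0.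
by have := pi_funP v; rewrite -[pi_fun v]/(pi n v) v0 raddf0 subr0.
Qed.

(** For a rayless Morse matching, the critical elements of degree n, here
    indexed by I n, form a basis of the quotient by the matched part. *)
Theorem rayless_morse_complex : exists N : chain_complex,
  (forall n, exists c : I n -> N n, is_basis c) /\
  (forall n, group_isomorphic (homology N n) (homology K n)).
Proof.
have sigmaK n m : pi n (sigma n m) = m.
  by apply: pi_fun_eq; rewrite subrr rpred0.
have ker_diff n v : pi n.+1 v = 0 -> pi n (diff K n v) = 0.
  move=> /pi_eq0/matched_partP[d [d' [dU dU' ->]]]; apply/pi_eq0/matched_partP.
  by exists 0, d; rewrite rpred0 raddfD /= diff_diff add0r addr0.
have ker_acyclic n v : pi n v = 0 -> v \in cycles K n ->
    exists2 w, pi n.+1 w = 0 & v = diff K n w.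
  move=> /pi_eq0/matched_partP[d [d' [dU dU' ->]]] vZ.
  exists d'.
    by apply/pi_eq0/matched_partP; exists d', 0; rewrite dU' rpred0 raddf0 addr0.
  suff -> : d = 0 by rewrite add0r.
  case: n {v} d d' dU dU' vZ => [|n] d d' dU dU' vZ.
    apply/(cell_coord_eq0 (c := b))/freegP => x; rewrite coeff0.
    apply/eqP/negPn/negP => xd; move/cell_coord_degree: (xd) => dx.
    have [y /M_degree] : upper x by move/supportedP: dU; apply; rewrite mem_dom.
    by rewrite dx.
  apply: diff_upper_inj => // y _.
  by move: vZ; rewrite inE raddfD /= diff_diff addr0 => /eqP ->; rewrite raddf0 coeff0.
exists (quotient_complex sigmaK ker_diff); split=> n; last first.
  exact: quotient_homology.
exists (fun i => << i >> : {freeg (I n) / int}) => v; exists v; split.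
  exact: freeg_sumMz.
by move=> c ->; rewrite -freeg_sumMz.
Qed.

End Morse.

(** * Rays in digraphs *)

Section Digraph.
Context (T : Type) (e : rel T).
Implicit Types (x y : T) (r s v w : nat -> T).

Definition walk w := forall i, e (w i) (w i.+1).
Definition live x := exists2 w, walk w & w 0%N = x.
Definition pure x := live x /\
  forall v w, walk v -> walk w -> v 0%N = x -> w 0%N = x -> v =1 w.
Definition step s x y := exists2 i, s i = x & s i.+1 = y.
Definition merge r s := exists K N : nat, forall i, r (K + i)%N = s (N + i)%N.

Lemma walk_tail w K : walk w -> walk (fun i => w (K + i)%N).
Proof. by move=> ww i; rewrite addnS. Qed.

Lemma live_walk w i : walk w -> live (w i).
Proof.
by move=> ww; exists (fun j => w (i + j)%N); rewrite ?addn0 //; exact: walk_tail.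
Qed.

Lemma live_step x : live x -> exists2 y, live y & e x y.
Proof. by move=> [w ww <-]; exists (w 1%N); [exact: live_walk|exact: ww]. Qed.

Hypothesis walk_inj : forall w, walk w -> injective w.

Lemma pure_walk_eq x v w : pure x -> walk v -> walk w -> v 0%N = x -> w 0%N = x ->
  v =1 w.
Proof. by move=> [_ h]; exact: h. Qed.

Definition walk_cons x w i := if i is j.+1 then w j else x.

Lemma walk_consP x w : e x (w 0%N) -> walk w -> walk (walk_cons x w).
Proof. by move=> xw ww [|i] /=. Qed.

Lemma pure_step x y w : pure x -> walk w -> w 0%N = x -> live y -> e x y -> y = w 1%N.
Proof.
move=> px ww w0 [v vv v0] xy.
have cv : walk (walk_cons x v) by apply: walk_consP; rewrite ?v0.
by rewrite -(pure_walk_eq px cv ww erefl w0) /= v0.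
Qed.

Lemma walk_prefix_tail w v i : walk w -> walk v -> v 0%N = w i ->
  walk (fun j => if (j < i)%N then w j else v (j - i)%N).
Proof.
move=> ww vv v0 j; case: ltnP => ji; case: ltnP => ji'.
- exact: ww.
- have -> : i = j.+1 by lia.
  by rewrite subnn v0 (_ : i = j.+1) //; lia.
- by lia.
- by rewrite subSn.
Qed.

Lemma pure_tail w i : walk w -> pure (w 0%N) -> pure (w i).
Proof.
move=> ww pw; split; first exact: live_walk.
suff h v : walk v -> v 0%N = w i -> forall j, v j = w (i + j)%N.
  by move=> u v uu vv u0 v0 j; rewrite (h u) // (h v).
move=> vv v0 j.
have cv := walk_prefix_tail ww vv v0.
have c0 : (fun j => if (j < i)%N then w j else v (j - i)%N) 0%N = w 0%N.
  by case: (i) v0 => //= ->.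
have := pure_walk_eq pw cv ww c0 erefl (i + j)%N.
by rewrite ltnNge leq_addr /= addKn.
Qed.

(** A diagonal argument. If no vertex is pure, every walk passes infinitely
    often through vertices with two live successors. A walk is built in which the
    counter m records how many representatives have been dealt with in turn
    (cyclically, via m modulo k). At each vertex it takes a step that is not a
    step of the current representative whenever a live successor allows this,
    and then moves to the next one. If the counter stalls, all later live
    successors are forced by an injective walk, and a pure vertex has been
    found. Otherwise the walk leaves each of the k representatives infinitely
    often and merges with none of them. *)
Lemma pure_exists (k : nat) (f : nat -> nat -> T) x0 :
  (0 < k)%N -> (forall j, walk (f j)) ->
  (forall w, walk w -> exists2 j, (j < k)%N & merge w (f j)) ->
  live x0 -> exists x, pure x.
Proof.
move=> k0 fw fmerge lx0; apply: contrapT => nopure.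
pose s m := f (m %% k)%N.
pose next (p q : T * nat) := [/\ live q.1, e p.1 q.1 &
  (q.2 = p.2.+1 /\ ~ step (s p.2) p.1 q.1) \/
  (q.2 = p.2 /\ forall y, live y -> e p.1 y -> step (s p.2) p.1 y)].
have /choice[g gP] p : exists q, live p.1 -> next p q.
  have [lp|nlp] := pselect (live p.1); last by exists p.
  have [[y [ly py nst]]|none] :=
      pselect (exists y, [/\ live y, e p.1 y & ~ step (s p.2) p.1 y]).
    by exists (y, p.2.+1) => _; split=> //; left.
  have [y ly py] := live_step lp; exists (y, p.2) => _; split=> //; right.
  split=> // z lz pz; apply: contrapT => nst; apply: none; by exists z.
pose st i := iter i g (x0, 0%N).
have lst i : live (st i).1 by elim: i => //= i /gP[].
have stP i : next (st i) (st i.+1) by exact: gP.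
pose w i := (st i).1; pose m i := (st i).2.
have ww : walk w by move=> i; have [] := stP i.
have incr i : exists2 j, (i <= j)%N & m j.+1 = (m j).+1.
  apply: contrapT => none; apply: nopure; exists (w i).
  have stuck j : m (i + j)%N = m i /\ forall y, live y -> e (w (i + j)%N) y ->
      step (s (m i)) (w (i + j)%N) y.
    have stuck1 l : (i <= l)%N -> m l.+1 = m l /\
        forall y, live y -> e (w l) y -> step (s (m l)) (w l) y.
      move=> il; have [_ _ [[h _]|[h1 h2]]] := stP l; last by [].
      by case: none; exists l.
    have mE : m (i + j)%N = m i.
      elim: j => [|j IH]; first by rewrite addn0.
      by rewrite addnS (stuck1 _ (leq_addr _ _)).1.
    by split=> //; have [_] := stuck1 _ (leq_addr j i); rewrite mE.
  split; first exact: lst.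
  suff h v : walk v -> v 0%N = w i -> forall j, v j = w (i + j)%N.
    by move=> u v uu vv u0 v0 j; rewrite (h u) // (h v).
  move=> vv v0; elim=> [|j IH]; first by rewrite addn0.
  have [_ h] := stuck j.
  have [a a1 a2] := h _ (live_walk j.+1 vv) (etrans (congr1 (e^~ _) (esym IH)) (vv j)).
  have [c c1 c2] := h _ (lst (i + j).+1) (ww (i + j)%N).
  rewrite addnS -a2 -[w _.+1]c2; congr (s (m i) _.+1).
  by apply: (walk_inj (fw (m i %% k)%N)); rewrite -/(s _) a1 c1.
have [j jk [K [N wf]]] := fmerge w ww.
have fstep i : (K <= i)%N -> step (f j) (w i) (w i.+1).
  move=> Ki; exists (N + (i - K))%N; rewrite -?addnS -wf; congr w; lia.
(* A counter value that selects f j and is not exceeded at time K, after which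
   all steps of w are steps of f j. *)
pose target := (m K * k + j)%N.
have : exists l, (target < m (K + l))%N.
  elim: target => [|B [l IH]].
    by have [l Kl ml] := incr K; exists (l.+1 - K)%N; rewrite subnKC ?ml // leqW.
  have [l' ll' ml'] := incr (K + l)%N; exists (l'.+1 - K)%N.
  rewrite subnKC; last by lia.
  rewrite ml' ltnS.
  have mono a c : (a <= c)%N -> (m a <= m c)%N.
    move=> ac; rewrite -(subnKC ac); elim: (c - a)%N => [|d IHd]; first by rewrite addn0.
    apply: leq_trans IHd _; rewrite addnS.
    by rewrite /m; have [_ _ [[-> _]|[-> _]]] := stP (a + d)%N.
  exact: leq_trans IH (mono _ _ ll').
move=> ex; case: (ex_minnP ex) => -[|l].
  rewrite addn0 /target => h _; have : (m K <= m K * k)%N by rewrite leq_pmulr.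
  by move: h; lia.
rewrite addnS => h /(_ l) hmin.
have ml : (m (K + l) <= target)%N.
  by rewrite leqNgt; apply/negP => /hmin; rewrite ltnn.
have [_ _ [[mE nst]|[mE _]]] := stP (K + l)%N; last by rewrite /m mE -/(m _) in h; lia.
have mt : m (K + l)%N = target by rewrite /m mE -/(m _) in h; lia.
apply: nst; rewrite -/(m _) mt /s /target modnMDl modn_small //.
by apply: fstep; exact: leq_addr.
Qed.

(** The relation e' arises from e by reversing the arrows of a walk r that
    starts at a pure vertex. *)
Section Reverse.
Context (e' : rel T) (r : nat -> T).
Hypothesis r_walk : walk r.
Hypothesis r_pure : pure (r 0%N).
Hypothesis e'_reverse : forall x y, e' x y ->
  (e x y /\ ~ step r x y) \/ step r y x.
Hypothesis e'_off : forall x y, e x y ->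
  (forall i, r i <> x) -> (forall i, r i <> y) -> e' x y.

Lemma live_cons x y : e x y -> live y -> live x.
Proof.
move=> xy [w ww w0]; exists (walk_cons x w) => //.
by apply: walk_consP => //; rewrite w0.
Qed.

Definition reversed_walk w := forall i, e' (w i) (w i.+1).

(** From a vertex that starts no infinite walk for e, all steps are steps of e:
    the reversed arrows start on r, whose vertices are live. *)
Lemma reversed_walk_live w : reversed_walk w -> live (w 0%N).
Proof.
move=> w'; apply: contrapT => dead.
have h i : ~ live (w i) -> e (w i) (w i.+1).
  move=> di; have [[]//|[j _ ri]] := e'_reverse (w' i).
  by case: di; rewrite -ri; exact: live_walk.
have allD i : ~ live (w i).
  by elim: i => // i IH lw; exact: IH (live_cons (h _ IH) lw).
by apply: dead; exists w => // i; apply: h.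
Qed.

(** From r j a walk for e' can only go back to the previous vertex of r or leave
    r. The first happens at most j times, and the second leads to a vertex that
    is not live, as the unique live successor of a vertex of r is the next
    one. *)
Lemma reversed_walk_avoids w i j : reversed_walk w -> r j <> w i.
Proof.
suff h j' v : reversed_walk v -> r j' <> v 0%N.
  move=> w' rw; apply: (h j (fun l => w (i + l)%N)); last by rewrite addn0.
  by move=> l; rewrite addnS.
elim: j' v => [|l IH] v v' rv; have [[vv nst]|] := e'_reverse (v' 0%N).
- apply: nst; exists 0%N => //.
  by rewrite -(pure_step r_pure r_walk erefl _ (y := v 1%N)) ?rv //;
     apply: (@reversed_walk_live (fun i => v i.+1)) => m.
- case=> a a1 a2; rewrite -rv in a2.
  by have := walk_inj r_walk a2.
- apply: nst; exists l.+1 => //.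
  have tw := walk_tail l.+1 r_walk.
  have tp := pure_tail l.+1 r_walk r_pure.
  rewrite (pure_step tp tw _ _ (y := v 1%N)) ?addn1 ?addn0 ?rv //.
  by apply: (@reversed_walk_live (fun i => v i.+1)) => m.
- case=> a a1 a2; rewrite -rv in a2; have /= [al] := walk_inj r_walk a2.
  by apply: (IH (fun i => v i.+1)) => [m //|]; rewrite -al.
Qed.

Lemma reversed_walk_walk w : reversed_walk w -> walk w.
Proof.
move=> w' i; have [[]//|[j _ rj]] := e'_reverse (w' i).
by case: (@reversed_walk_avoids w i j.+1 w').
Qed.

Lemma walk_reversed w : walk w -> (forall i j, r j <> w i) -> reversed_walk w.
Proof. by move=> ww h i; exact: e'_off. Qed.

Lemma merge_reversed w i j : walk w -> r j = w i -> merge r w.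
Proof.
move=> ww rw; exists j, i => l.
have h := pure_walk_eq (pure_tail j r_walk r_pure) (walk_tail j r_walk) (walk_tail i ww).
by apply: h; rewrite addn0.
Qed.

End Reverse.
End Digraph.

(** * Reversing the rays of a Morse matching *)

Lemma path_mkseq (T : Type) (e : rel T) (w : nat -> T) n :
  (forall i, e (w i) (w i.+1)) -> path e (w 0%N) (mkseq (fun i => w i.+1) n).
Proof.
move=> ww; elim: n => // n IH; rewrite mkseqS rcons_path IH /=.
suff -> : last (w 0%N) (mkseq (fun i => w i.+1) n) = w n by [].
by case: (n) => // m; rewrite mkseqS last_rcons.
Qed.

(** A cycle is the same as an infinite walk that revisits a vertex: cut the walk
    between two visits, or run around the cycle forever. *)
Lemma acyclic_walk_inj (T : eqType) (e : rel T) :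
  (forall c, c != [::] -> ~~ cycle e c) <->
  (forall w, walk e w -> injective w).
Proof.
split=> [nocycle w ww|inj [//|x p] _].
  suff h i j : (i < j)%N -> w i <> w j.
    move=> i j wij; case: (ltngtP i j) => // [/h/(_ wij)//|/h/(_ (esym wij))//].
  move=> ij wij; pose v l := w (i + l)%N.
  have := nocycle (v 0%N :: mkseq (fun l => v l.+1) (j - i).-1) isT.
  have v0 : v 0%N = v (j - i).-1.+1.
    by rewrite /v prednK ?subn_gt0 // subnKC ?addn0 // ltnW.
  rewrite /cycle {2}v0 -(mkseqS (fun l => v l.+1)) path_mkseq //.
  exact: (walk_tail i ww).
apply/negP => /= xp; pose n := (size p).+1.
pose w i := nth x (x :: p) (i %% n).
have ww : walk e w.
  move=> i; rewrite /w; have iq : (i %% n < n)%N by rewrite ltn_mod.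
  have := (pathP x xp (i %% n)%N); rewrite size_rcons => /(_ iq).
  have -> : nth x (x :: rcons p x) (i %% n)%N = nth x (x :: p) (i %% n)%N.
    rewrite -rcons_cons nth_rcons /= -/n iq.
    by [].
  have -> : nth x (rcons p x) (i %% n)%N = nth x (x :: p) (i.+1 %% n)%N.
    rewrite -(addn1 i) -modnDml addn1 nth_rcons.
    case: ltngtP => [iqp|iqp|->]; last by rewrite modnn.
    - by rewrite (@modn_small (i %% n).+1).
    - by have := leq_ltn_trans iqp iq; rewrite ltnn.
  by [].
have /(inj w ww) : w 0%N = w n by rewrite /w modnn mod0n.
by [].
Qed.

Section Rays.
Context (disp : Order.disp_t) (P : porderType disp).
Implicit Types (x y : P) (M : set (P * P)) (r s t w : nat -> P) (n : nat).
Hypothesis Pgr : graded P.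

Lemma morse_walk_inj M w : morse_matching M -> walk (hasse_arrow M) w -> injective w.
Proof. by move=> [_ /acyclic_walk_inj]; exact. Qed.

Lemma morse_is_ray M w : morse_matching M -> walk (hasse_arrow M) w -> is_ray M w.
Proof. by move=> Mm ww; split=> //; exact: morse_walk_inj ww. Qed.

Definition alternating M w := forall i, [/\ M (w i.*2.+1, w i.*2),
  covers (w i.*2.+1) (w i.*2.+2) & ~ M (w i.*2.+1, w i.*2.+2)].

Lemma covers_irr x : ~ covers x x.
Proof. by case; rewrite ltxx. Qed.

(** From a vertex of minimal degree the walk must go up. After a step up it
    cannot go up again, as a vertex belongs to one matched arrow only; so it
    returns to the minimal degree. *)
Lemma alternating_min M w : matching M -> walk (hasse_arrow M) w ->
  (forall j, degree (w 0%N) <= degree (w j))%N ->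
  alternating M w /\ forall i, degree (w i.*2) = degree (w 0%N).
Proof.
move=> [Mc Md] ww wmin.
have up i : degree (w i.*2) = degree (w 0%N) -> M (w i.*2.+1, w i.*2).
  move=> di; have /asboolP[[/(degree_covers Pgr) dE _]|//] := ww i.*2.
  by have := wmin i.*2.+1; rewrite -di dE ltnn.
have down i : M (w i.*2.+1, w i.*2) ->
    covers (w i.*2.+1) (w i.*2.+2) /\ ~ M (w i.*2.+1, w i.*2.+2).
  move=> Mi; have /asboolP[//|Mi'] := ww i.*2.+1.
  have [_ E] : (w i.*2.+2, w i.*2.+1) = (w i.*2.+1, w i.*2).
    by apply: Md Mi' Mi _; constructor 3.
  by case: (covers_irr (x := w i.*2)); rewrite -{1}E; exact: Mc.
have deg i : degree (w i.*2) = degree (w 0%N).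
  elim: i => // i IH; have Mi := up i IH; have [ci _] := down i Mi.
  apply: succn_inj; rewrite doubleS -(degree_covers Pgr ci) -IH.
  by rewrite (degree_covers Pgr (Mc _ _ Mi)).
split=> // i; have Mi := up i (deg i).
by have [] := down i Mi.
Qed.

Lemma walk_min_degree w : exists j, forall i, (degree (w j) <= degree (w i))%N.
Proof.
have ex : exists d, `[< exists i, degree (w i) = d >].
  by exists (degree (w 0%N)); apply/asboolP; exists 0%N.
case: (ex_minnP ex) => d /asboolP[j <-] dmin; exists j => i.
by apply: dmin; apply/asboolP; exists i.
Qed.

(** The minimal degree is attained infinitely often, hence also on the common
    tail. *)
Lemma ray_degree_le M s t n m : matching M -> walk (hasse_arrow M) s ->
  ray_equiv s t -> ray_degree s n -> ray_degree t m -> (m <= n)%N.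
Proof.
move=> Mm ws [K [N st]] [[j sj] smin] [_ tmin].
have [|_ h] := alternating_min Mm (walk_tail j ws); first by rewrite addn0 sj.
have := h K; rewrite addn0 sj => <-.
have -> : (j + K.*2 = K + (j + K))%N by lia.
by rewrite st.
Qed.

Lemma ray_equiv_refl r : ray_equiv r r.
Proof. by exists 0%N, 0%N. Qed.

Lemma ray_equiv_sym r s : ray_equiv r s -> ray_equiv s r.
Proof. by move=> [K [N rs]]; exists N, K => i; rewrite rs. Qed.

Lemma ray_equiv_trans r s t : ray_equiv r s -> ray_equiv s t -> ray_equiv r t.
Proof.
move=> [K [N rs]] [K' [N' st]]; exists (K + K')%N, (N' + N)%N => i.
rewrite -addnA rs (_ : N + (K' + i) = K' + (N + i))%N; last by lia.
by rewrite st; congr t; lia.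
Qed.

Lemma ray_class_eq M r s : ray_equiv r s -> ray_class M r = ray_class M s.
Proof.
move=> rs; apply/seteqP; split=> t [tM rt]; split=> //.
  exact: ray_equiv_trans (ray_equiv_sym rs) rt.
exact: ray_equiv_trans rs rt.
Qed.

Section ReverseRay.
Context (M : set (P * P)) (r : nat -> P).
Hypothesis Mmorse : morse_matching M.
Hypothesis r_ray : is_ray M r.
Hypothesis r_alt : alternating M r.
Hypothesis r_pure : pure (hasse_arrow M) (r 0%N).

(** The matched arrows of r are replaced by its unmatched ones. In the digraph of
    the matching this reverses every arrow of r, and r 0 becomes critical. *)
Definition reversal : set (P * P) :=
  [set p | (M p /\ forall i, p <> (r i.*2.+1, r i.*2)) \/
           exists i, p = (r i.*2.+1, r i.*2.+2) ].

Let r_inj : injective r. Proof. by case: r_ray. Qed.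
Let r_walk : walk (hasse_arrow M) r. Proof. by case: r_ray. Qed.
Let Mm : matching M. Proof. by case: Mmorse. Qed.

(** The partner of the vertex l of r is its successor for l even and its
    predecessor for l odd; both cases are covered by rounding l down to an even
    number. *)
Lemma M_ray_vertex x y l : M (x, y) -> r l = x \/ r l = y ->
  (x, y) = (r l./2.*2.+1, r l./2.*2).
Proof.
move=> xy rl; have [Mi _ _] := r_alt l./2.
have := odd_double_half l; case: Mm => _ Md.
case: (odd l) => /= lE.
  have E : r l = r l./2.*2.+1 by congr r; rewrite -add1n lE.
  by apply: Md xy Mi _; rewrite -E; case: rl => ->; [constructor 1|constructor 3].
have E : r l = r l./2.*2 by congr r; rewrite -[RHS]add0n lE.
by apply: Md xy Mi _; rewrite -E; case: rl => ->; [constructor 2|constructor 4].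
Qed.

Lemma reversal_old_off x y l : M (x, y) ->
  (forall i, (x, y) <> (r i.*2.+1, r i.*2)) -> r l <> x /\ r l <> y.
Proof.
by move=> xy nr; split=> rl; apply: (nr l./2); apply: M_ray_vertex => //;
  [left|right].
Qed.

Lemma reversal_matching : matching reversal.
Proof.
case: (Mm) => Mc Md; split=> [x y [[/Mc//]|[i [-> ->]]]|x y x' y'].
  by have [] := r_alt i.
have mixed i a c : M (a, c) -> (forall j, (a, c) <> (r j.*2.+1, r j.*2)) ->
    [\/ a = r i.*2.+1, a = r i.*2.+2, c = r i.*2.+1 | c = r i.*2.+2] -> False.
  move=> ac nr; have h l := reversal_old_off l ac nr.
  by case=> E; [case: (h i.*2.+1)|case: (h i.*2.+2)|case: (h i.*2.+1)|
     case: (h i.*2.+2)]; rewrite -E.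
move=> [[xy nr]|[i [-> ->]]] [[xy' nr']|[j [-> ->]]] sh.
- exact: Md xy xy' sh.
- by case: (mixed j x y xy nr); case: sh => ->; [constructor 1|constructor 2|constructor 3|constructor 4].
- by case: (mixed i x' y' xy' nr'); case: sh => <-; [constructor 1|constructor 3|constructor 2|constructor 4].
- suff -> : i = j by [].
  by case: sh => /r_inj; lia.
Qed.

Lemma reversal_arrow x y : hasse_arrow reversal x y ->
  (hasse_arrow M x y /\ ~ step r x y) \/ step r y x.
Proof.
case: (Mm) => Mc _.
move=> /asboolP[[xy nR]|[[yx nr]|[i [-> ->]]]]; last by right; exists i.*2.+1.
  have [Mxy|nM] := pselect (M (x, y)).
    have [[i [-> ->]]|none] := pselect (exists i, (x, y) = (r i.*2.+1, r i.*2)).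
      by right; exists i.*2.
    by case: nR; left; split=> // i xyi; apply: none; exists i.
  left; split; first by apply/asboolP; left.
  move=> [i xi yi]; have := odd_double_half i; case: (odd i) => /= iE.
    apply: nR; right; exists i./2; rewrite -xi -yi -{1 2}iE.
    by rewrite add1n.
  have [/Mc [yx _] _ _] := r_alt i./2; case: xy => xy _.
  move: yx; rewrite -[i./2.*2]add0n iE xi yi => /(lt_trans xy).
  by rewrite ltxx.
left; split; first by apply/asboolP; right.
by move=> [i xi _]; have [_] := reversal_old_off i yx nr.
Qed.

Lemma reversal_arrow_off x y : hasse_arrow M x y ->
  (forall i, r i <> x) -> (forall i, r i <> y) -> hasse_arrow reversal x y.
Proof.
move=> /asboolP[[xy nM]|yx] nx ny; apply/asboolP.
  left; split=> // -[[]//|[i [xi _]]]; by apply: (nx i.*2.+1).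
by right; left; split=> // i [yi _]; apply: (ny i.*2.+1).
Qed.

Let M_walk_inj := fun w => @morse_walk_inj M w Mmorse.

Lemma reversal_walk w : walk (hasse_arrow reversal) w -> walk (hasse_arrow M) w.
Proof. exact: (reversed_walk_walk M_walk_inj r_walk r_pure reversal_arrow). Qed.

Lemma reversal_avoids w i j : walk (hasse_arrow reversal) w -> r j <> w i.
Proof.
move=> w'.
exact: (reversed_walk_avoids M_walk_inj r_walk r_pure reversal_arrow (w := w) (i := i) (j := j)).
Qed.

Lemma reversal_morse : morse_matching reversal.
Proof.
split; first exact: reversal_matching.
by apply/acyclic_walk_inj => w /reversal_walk/M_walk_inj.
Qed.

Lemma reversal_ray_class s : is_ray reversal s ->
  is_ray M s /\ ray_class reversal s = ray_class M s.
Proof.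
move=> [s_inj s_walk]; have sM := reversal_walk s_walk; split=> //.
apply/seteqP; split=> t [[t_inj t_walk] st]; split=> //; split=> //.
  exact: reversal_walk.
apply: (walk_reversed reversal_arrow_off t_walk) => i j rt.
have rmt : ray_equiv r t by exact: (merge_reversed r_walk r_pure t_walk rt).
have [K [N rs]] := ray_equiv_trans rmt (ray_equiv_sym st).
by have := rs 0%N; exact: reversal_avoids.
Qed.

Lemma reversal_ray_classes :
  ray_classes reversal `<=` ray_classes M `\ ray_class M r.
Proof.
move=> _ [s sR <-]; have [sM ->] := reversal_ray_class sR; split.
  by exists s.
move=> E; have : ray_class M s s by split=> //; exact: ray_equiv_refl.
rewrite E => -[_ [K [N rs]]]; have := rs 0%N.
by apply: reversal_avoids; case: sR.
Qed.

Lemma ray_reversal s : is_ray M s -> ~ ray_equiv r s -> is_ray reversal s.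
Proof.
move=> [s_inj s_walk] nrs; split=> //.
apply: (walk_reversed reversal_arrow_off s_walk) => i j rs; apply: nrs.
exact: (merge_reversed r_walk r_pure s_walk rs).
Qed.

Lemma reversal_critical x :
  critical reversal x <-> critical M x \/ x = r 0%N.
Proof.
split=> [xR|[xM|->] y].
- have [|nM] := pselect (critical M x); [by left|right].
  have [i xi] : exists i, r i = x.
    apply: contrapT => none; apply: nM => y; split=> h.
      by case: (xR y) => + _; apply; left; split=> // i [xi _]; apply: none; exists i.*2.+1.
    by case: (xR y) => _; apply; left; split=> // i [_ xi]; apply: none; exists i.*2.
  have := odd_double_half i; case: (odd i) => /= iE.
    by case: (xR (r i./2.*2.+2)) => + _; case; right; exists i./2; rewrite -xi -{1}iE.
  case: (i./2) iE => [|j] iE; first by rewrite -xi -iE.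
  by case: (xR (r j.*2.+1)) => _; case; right; exists j; rewrite -xi -iE.
- split=> -[[h _]|[i [E F]]].
  + by case: (xM y).
  + by have [h _ _] := r_alt i; case: (xM (r i.*2)) => + _; rewrite E.
  + by case: (xM y).
  + have [h _ _] := r_alt i.+1; case: (xM (r i.+1.*2.+1)) => _; rewrite F; exact.
- split=> -[[h nr]|[i [E F]]].
  + by case: (reversal_old_off 0%N h nr).
  + by have := r_inj E.
  + by case: (reversal_old_off 0%N h nr).
  + by have := r_inj F.
Qed.

Lemma reversal_origin_not_critical : ~ critical M (r 0%N).
Proof. by move=> /(_ (r 1%N)) [_]; have [] := r_alt 0%N. Qed.

End ReverseRay.

Lemma pure_alternating_ray M : morse_matching M -> finite_set (ray_classes M) ->
  (exists w, walk (hasse_arrow M) w) -> exists r,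
  [/\ is_ray M r, alternating M r, pure (hasse_arrow M) (r 0%N) &
      ray_degree r (degree (r 0%N))].
Proof.
move=> Mm /finite_seqP[l lE] [w0 w0w].
have inj w := @morse_walk_inj M w Mm.
have /choice[f fP] (rho : set (nat -> P)) : exists s,
    walk (hasse_arrow M) s /\ (ray_classes M rho -> rho = ray_class M s).
  have [[s sM <-]|n] := pselect (ray_classes M rho); last by exists w0.
  by exists s; split=> //; case: sM.
have cls w : walk (hasse_arrow M) w -> ray_class M w \in l.
  move=> ww; have : ray_classes M (ray_class M w).
    by exists w => //; exact: morse_is_ray.
  by rewrite lE.
have [x [[w ww w0x] wx]] : exists x, pure (hasse_arrow M) x.
  apply: (@pure_exists _ _ inj (size l) (fun j => f (nth set0 l j)) (w0 0%N)).
  - by have := cls _ w0w; case: (l).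
  - by move=> j; case: (fP (nth set0 l j)).
  - move=> w ww; have wl := cls w ww.
    exists (index (ray_class M w) l); first by rewrite index_mem.
    rewrite nth_index //; have [_ h] := fP (ray_class M w).
    have E : ray_class M w = ray_class M (f (ray_class M w)).
      by apply: h; exists w => //; exact: morse_is_ray.
    have : ray_class M w w by split; [exact: morse_is_ray|exact: ray_equiv_refl].
    by rewrite {1}E => -[_ /ray_equiv_sym].
  - by exists w0.
have px : pure (hasse_arrow M) (w 0%N).
  by rewrite w0x; split=> //; exists w.
have [j jmin] := walk_min_degree w.
have tw := walk_tail j ww.
have [|alt _] := alternating_min (proj1 Mm) tw; first by rewrite addn0.
exists (fun i => w (j + i)%N); split=> //.
- exact: morse_is_ray.
- by have := pure_tail j ww px; rewrite addn0.
- by split=> [|i]; [exists 0%N|rewrite addn0].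
Qed.

(** Reversing a pure ray removes exactly its class, so finitely many reversals
    leave a rayless Morse matching. T s is the element made critical by the
    reversal of the ray class of s; it has the degree of the ray. T is defined
    on sequences rather than on classes so that it exists for empty P. *)
Theorem reverse_all_rays M : morse_matching M -> finite_set (ray_classes M) ->
  exists M2 (T : (nat -> P) -> P), [/\ morse_matching M2,
    forall w, ~ walk (hasse_arrow M2) w,
    forall s t, is_ray M s -> is_ray M t -> T s = T t <-> ray_equiv s t,
    forall s, is_ray M s -> ~ critical M (T s) /\
      exists t, [/\ is_ray M t, ray_equiv s t & ray_degree t (degree (T s))] &
    forall x, critical M2 x <->
      critical M x \/ exists2 s, is_ray M s & T s = x].
Proof.
move=> Mm /finite_seqP[l lE]; have {lE} : ray_classes M `<=` [set` l] by rewrite lE.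
move: {2}(size l).+1 (ltnSn (size l)) => k; elim: k => // k IH in M l Mm *.
move=> ls Ml; have [[w ww]|nowalk] := pselect (exists w, walk (hasse_arrow M) w);
  last first.
  have noray s : ~ is_ray M s by case=> _ sw; apply: nowalk; exists s.
  exists M, (fun s => s 0%N); split=> //.
  - by move=> w ww; apply: nowalk; exists w.
  - by move=> s t /noray.
  - by move=> s /noray.
  - by move=> x; split=> [|[//|[s /noray]]]; [left|].
have Mfin : finite_set (ray_classes M).
  by apply: sub_finite_set Ml _; apply/finite_seqP; exists l.
have [r [r_ray r_alt r_pure r_deg]] := pure_alternating_ray Mm Mfin (ex_intro _ w ww).
pose rho0 := ray_class M r.
have [||M3 [T [M3m M3w Tinj Tdeg Tcrit]]] := IH (reversal M r)
    [seq rho <- l | rho != rho0] (reversal_morse Mm r_ray r_alt r_pure).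
- rewrite -ltnS; apply: leq_trans ls; rewrite ltnS size_filter.
  rewrite -(count_predC (pred1 rho0) l) -[X in (X < _)%N]add0n ltn_add2r.
  by rewrite -has_count has_pred1; apply: Ml; exists r.
- move=> rho /(reversal_ray_classes Mm r_ray r_alt r_pure)[/Ml rl ne].
  by rewrite /= mem_filter [rho \in l]rl andbT; apply/eqP.
have RM s : is_ray (reversal M r) s -> is_ray M s.
  by move=> /(reversal_ray_class Mm r_ray r_alt r_pure)[].
have split_ray s : is_ray M s -> ray_equiv r s \/
    (~ ray_equiv r s /\ is_ray (reversal M r) s).
  move=> Ms; have [|ne] := pselect (ray_equiv r s); [by left|right; split=> //].
  exact: (ray_reversal r_ray r_pure).
pose T' s := if pselect (ray_equiv r s) then r 0%N else T s.
have T'0 s : ray_equiv r s -> T' s = r 0%N by rewrite /T'; case: pselect.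
have T'1 s : ~ ray_equiv r s -> T' s = T s by rewrite /T'; case: pselect.
have crit := reversal_critical Mm r_ray r_alt.
have Tr s : is_ray (reversal M r) s -> T s <> r 0%N.
  by move=> /Tdeg[nc _] Tr; apply: nc; apply/crit; right.
exists M3, T'; split=> //.
- move=> s t /split_ray[rs|[ns Rs]] /split_ray[rt|[nt Rt]].
  + rewrite !T'0 //; split=> // _.
    exact: ray_equiv_trans (ray_equiv_sym rs) rt.
  + rewrite T'0 // T'1 //; split=> [/esym/(Tr _ Rt)//|st].
    by case: nt; exact: ray_equiv_trans rs st.
  + rewrite T'1 // T'0 //; split=> [/(Tr _ Rs)//|st].
    by case: ns; exact: ray_equiv_trans rt (ray_equiv_sym st).
  + by rewrite !T'1 //; exact: Tinj.
- move=> s /split_ray[rs|[ns Rs]].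
    rewrite T'0 //; split; first exact: reversal_origin_not_critical r_alt.
    by exists r; split=> //; exact: ray_equiv_sym.
  rewrite T'1 //; have [nc [t [Rt st dt]]] := Tdeg s Rs; split.
    by move=> cM; apply: nc; apply/crit; left.
  by exists t; split=> //; exact: RM.
- move=> x; split=> [/Tcrit[/crit[|->]|[s Rs <-]]|].
  + by left.
  + by right; exists r => //; rewrite T'0 //; exact: ray_equiv_refl.
  + right; exists s; first exact: RM.
    rewrite T'1 // => rs; have [K [N rsE]] := rs.
    by have := rsE 0%N; apply: (reversal_avoids Mm r_ray r_alt r_pure); case: Rs.
  + case=> [cx|[s /split_ray[rs|[ns Rs]] <-]].
    * by apply/Tcrit; left; apply/crit; left.
    * by apply/Tcrit; left; apply/crit; right; rewrite T'0.
    * by apply/Tcrit; right; exists s => //; rewrite T'1.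
Qed.

End Rays.

(** * The theorem *)

Theorem corollary5p3 (disp : Order.disp_t) (P : porderType disp)
    (M' : set (P * P)) :
  homologically_admissible P ->
  morse_matching M' ->
  finite_set (ray_classes M') ->
  exists M : chain_complex,
    (forall n : nat,
       exists b : critical_degree M' n + ray_classes_degree M' n -> M n,
         is_basis b) /\
    (forall n : nat,
       group_isomorphic (homology M n) (homology (cellular_complex P) n)).
Proof.
move=> Padm Mm Mfin; have Pgr : graded P by case: Padm.
have [M2 [T [M2m M2w Tinj Tdeg Tcrit]]] := reverse_all_rays Pgr Mm Mfin.
(* A ray of degree n in each class; the degree is part of the index. *)
have /choice[rep repP] (rho : {n & ray_classes_degree M' n}) :
    exists s, [/\ is_ray M' s, ray_degree s (projT1 rho) &
                  val (projT2 rho) = ray_class M' s].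
  case: rho => n [rho rhoP] /=.
  by have := rhoP; rewrite inE => -[s [sM sn] <-]; exists s.
pose beta n (i : (critical_degree M' n + ray_classes_degree M' n)%type) : P :=
  match i with
  | inl x => val x
  | inr rho => T (rep (existT _ n rho))
  end.
have T_degree s n : is_ray M' s -> ray_degree s n -> degree (T s) = n.
  move=> sM sn; have [_ [t [tM st tT]]] := Tdeg s sM.
  apply/eqP; rewrite eqn_leq.
  rewrite (ray_degree_le Pgr (proj1 Mm) (proj2 sM) st sn tT).
  by rewrite (ray_degree_le Pgr (proj1 Mm) (proj2 tM) (ray_equiv_sym st) tT sn).
have beta_inj n : injective (@beta n).
  move=> [[x xP]|rho] [[y yP]|sig] /=.
  - by move=> xy; congr inl; apply: val_inj.
  - move=> E; have [sM _ _] := repP (existT _ n sig).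
    by case: (Tdeg _ sM).1; rewrite -E; move: xP; rewrite inE => -[].
  - move=> E; have [sM _ _] := repP (existT _ n rho).
    by case: (Tdeg _ sM).1; rewrite E; move: yP; rewrite inE => -[].
  - have [sM _ /= sE] := repP (existT _ n rho).
    have [tM _ /= tE] := repP (existT _ n sig).
    move=> /(Tinj _ _ sM tM) st; congr inr; apply: val_inj.
    by apply: etrans sE _; apply: etrans (esym tE); exact: ray_class_eq.
have beta_critical n x : critical_degree M2 n x <-> exists i, @beta n i = x.
  split=> [[/Tcrit[xc|[s sM sx]] dx]|[[[y yP]|rho] <-]] /=.
  - have xP : x \in critical_degree M' n by rewrite inE.
    by exists (inl (SigSub xP)).
  - have [_ [t [tM st tT]]] := Tdeg s sM.
    have rhoP : ray_class M' t \in ray_classes_degree M' n.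
      by rewrite inE; exists t => //; split=> //; rewrite -dx -sx.
    exists (inr (SigSub rhoP)) => /=; have [uM _ /= uE] := repP (existT _ n (SigSub rhoP)).
    rewrite -sx; apply/(Tinj _ _ uM sM).
    apply: ray_equiv_trans (ray_equiv_sym st).
    have : ray_class M' t t by split=> //; exact: ray_equiv_refl.
    by move: (congr1 (@^~ t) uE) => /= -> -[].
  - by move: yP; rewrite inE => -[yc dy]; split=> //; apply/Tcrit; left.
  - have [sM sn _] := repP (existT _ n rho).
    split; last exact: T_degree.
    by apply/Tcrit; right; exists (rep (existT _ n rho)).
exact: (rayless_morse_complex (cellular_cell_basis Padm) Pgr M2m M2w beta_inj beta_critical).
Qed.
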